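(* Let $\mathcal{L}(\theta_{\mathcal{X},\mathcal{M},B})$, viewed as a function $\mathcal{L}(x)$ of the training configuration $x=[\mathcal{X},\mathcal{M}]$, be the performance landscape of the LLM training configuration, with bounded RKHS norm $\lVert\mathcal{L}\rVert_\kappa=\sqrt{\langle\mathcal{L},\mathcal{L}\rangle_\kappa}\le\mathcal{B}$ with respect to a kernel $\kappa$. Assume that the performance predictor $\mathcal{F}$ is learnt from $N$ full-training runs (of $B$ training steps each) over random training configurations, and that from $B_{\mathrm{small}}<B$ training steps it makes the prediction $$\mathcal{F}(\mathcal{L}(\theta_{\mathcal{X},\mathcal{M},B_{\mathrm{small}}}))=\mathcal{L}(\theta_{\mathcal{X},\mathcal{M},B})+\epsilon,$$ where the prediction error $\epsilon$ is $R$-sub-Gaussian with $R=\frac{k}{\sqrt{N}}$ for some constant $k$. Then running the algorithm JoBS (described in the context) over training configurations $\mathcal{X},\mathcal{M}$ until an optimization budget of $C$ training steps is exhausted yields $T=\left\lfloor\frac{C-NB}{B_{\mathrm{small}}}\right\rfloor$ Bayesian optimization (BO) iterations, and with the IGP-UCB acquisition function, JoBS yields the following average regret with probability at least $1-\delta$: $$\mathcal{R}_T=\mathcal{O}\left(\sqrt{\frac{B_{\mathrm{small}}}{C-NB-B_{\mathrm{small}}}}\left(\mathcal{B}\sqrt{\gamma_T}+\frac{k}{\sqrt{N}}\sqrt{\gamma_T^2+\gamma_T\ln(1/\delta)}\right)\right),$$ where $\gamma_T$ is the maximum information gain of $\mathcal{L}$ after $T=\left\lfloor\frac{C-NB}{B_{\mathrm{small}}}\right\rfloor$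 BO iterations.
   Context: Setting. A training configuration is a vector $x=[\mathcal{X},\mathcal{M}]\in\mathbb{R}^d$, where $\mathcal{X}$ is a data mixing ratio (a point of a probability simplex) and $\mathcal{M}$ is a vector of model configuration parameters. $\theta_{\mathcal{X},\mathcal{M},b}$ denotes the weights of a large language model (LLM) fine-tuned with configuration $[\mathcal{X},\mathcal{M}]$ for $b$ training steps, and $\mathcal{L}(\theta_{\mathcal{X},\mathcal{M},b})$ its value under a fixed performance metric. $\mathcal{L}(x)$ abbreviates $\mathcal{L}(\theta_{\mathcal{X},\mathcal{M},B})$, the performance after a full-training run of $B$ steps; it is a black-box function to be maximized, with maximizer $x^*=\arg\max_x\mathcal{L}(x)$. $\kappa$ is a kernel function on pairs of configurations, and $\langle\cdot,\cdot\rangle_\kappa$, $\lVert\cdot\rVert_\kappa$ are the inner product and norm of its reproducing kernel Hilbert space (RKHS). $C\ge B$ is the total optimization budget, counted in training steps. The algorithm JoBS. First, $N$ training configurations are sampled (a random Sobol sequence) and the LLM is fully trained ($B$ steps) on each, observing the performance both at $B_{\mathrm{small}}$ steps and at $B$ steps; this costs $NB$. These observations are used to fit the predictor $\mathcal{F}$, which maps a configuration and its performance at $B_{\mathrm{small}}$ steps to a prediction of its performance at $B$ steps (they are also used to fit the Gaussian process surrogate). Then BO is run: at each iteration $t=1,\dots,T$ a configuration $x_t$ is chosen by the acquisition function, the LLM is trained for only $B_{\mathrm{small}}$ steps, and the prediction of $\mathcal{F}$ is used as the noisy observation $y_t=\mathcal{L}(x_t)+\epsilon_t$, with $\epsilon_t$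 the prediction error, to update the Gaussian process. Each BO iteration costs $B_{\mathrm{small}}$. Sub-Gaussian. A noise variable $\epsilon$ is $R$-sub-Gaussian if $\mathbb{E}[e^{\lambda\epsilon}]\le e^{\lambda^2R^2/2}$ for all $\lambda\in\mathbb{R}$. Gaussian process posterior. Given observations $\mathbf{y}_t=(y_1,\dots,y_t)^\top$ at $x_1,\dots,x_t$, with $\kappa_t(x)=(\kappa(x,x_1),\dots,\kappa(x,x_t))^\top$, $K_t=[\kappa(x_i,x_j)]_{i,j\le t}$ and $\zeta=1+2/T$, the posterior mean and variance are $$\mu_t(x)=\kappa_t(x)^\top(K_t+\zeta I)^{-1}\mathbf{y}_t,\qquad \sigma_t^2(x)=\kappa(x,x)-\kappa_t(x)^\top(K_t+\zeta I)^{-1}\kappa_t(x).$$ Maximum information gain. $\gamma_t$ is the largest mutual information between $\mathcal{L}$ (under the Gaussian process model) and noisy observations of it at $t$ points, i.e. the maximum of $\tfrac12\ln\det(I+\zeta^{-1}K_A)$ over collections $A$ of $t$ configurations, where $K_A=[\kappa(x,x')]_{x,x'\in A}$. IGP-UCB acquisition. $x_t=\arg\max_x\,\mu_{t-1}(x)+\beta_t\sigma_{t-1}(x)$ with $\beta_t=\mathcal{B}+R\sqrt{2(\gamma_{t-1}+1+\ln(1/\delta))}$. Average regret. $\mathcal{R}_T=\frac1T\sum_{t=1}^T\big(\mathcal{L}(x^* )-\mathcal{L}(x_t)\big)$, over the $T$ BO iterations.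
   Formalization: The prediction errors are assumed R-sub-Gaussian conditionally on the current and past configurations and past errors, since the bound fails for merely unconditional sub-Gaussian errors; the kernel is taken jointly measurable and the information gains finite. *)

(* Defs.v *)
From HB Require Import structures.
From mathcomp Require Import all_boot all_order all_algebra.
From mathcomp Require Import sesquilinear.
From mathcomp Require Import all_classical all_reals all_analysis.
Import Order.TTheory GRing.Theory Num.Theory.
Import numFieldNormedType.Exports.

Set Implicit Arguments.
Unset Strict Implicit.
Unset Printing Implicit Defensive.

Local Open Scope classical_set_scope.
Local Open Scope ring_scope.

Definition simplex (R : realType) (m : nat) : set 'rV[R]_m :=
  [set w | (forall i, 0 <= w 0 i) /\ \sum_i w 0 i = 1].

Definition config_set (R : realType) (m p : nat) (Mod : set 'rV[R]_p) :
    set 'rV[R]_(m + p) :=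
  [set x | @simplex R m (lsubmx x) /\ Mod (rsubmx x)].

(* [set_type A] is the subtype of the elements of [A], with the topology induced
   by R^(m + p); [config x0] carries its Borel sigma-algebra.  The library's
   measurable types are pointed, and [x0] serves only as that point. *)
Definition config_points (R : realType) (m p : nat) (Mod : set 'rV[R]_p)
    (x0 : set_type (config_set (m := m) Mod)) := set_type (config_set (m := m) Mod).

HB.instance Definition _ R m p Mod x0 :=
  Topological.on (@config_points R m p Mod x0).
HB.instance Definition _ R m p Mod x0 :=
  isPointed.Build (@config_points R m p Mod x0) x0.

Definition config (R : realType) (m p : nat) (Mod : set 'rV[R]_p)
    (x0 : set_type (config_set (m := m) Mod)) :=
  g_sigma_algebraType (@open (config_points x0)).

(* A Hilbert space (complete normed module whose norm comes from a dot product)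
   whose elements are identified with functions on X by the injection
   [rkhs_fun]; [rkhs_section x] is the element kappa(x, .).  The existence of
   such a space forces kappa to be symmetric and positive semidefinite. *)
Record rkhs (R : realType) (X : Type) (kappa : X -> X -> R) := Rkhs {
  rkhs_space :> completeNormedModType R;
  rkhs_dot : {dot rkhs_space for idfun};
  rkhs_normE : forall f : rkhs_space, rkhs_dot f f = `|f| ^+ 2;
  rkhs_fun : rkhs_space -> X -> R;
  rkhs_fun_linear : forall (a : R) (f g : rkhs_space) (x : X),
    rkhs_fun (a *: f + g) x = a * rkhs_fun f x + rkhs_fun g x;
  rkhs_fun_inj : injective rkhs_fun;
  rkhs_section : X -> rkhs_space;
  rkhs_sectionE : forall x, rkhs_fun (rkhs_section x) = kappa x;
  rkhs_reproducing : forall (f : rkhs_space) (x : X),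
    rkhs_fun f x = rkhs_dot f (rkhs_section x)
}.

Section GaussianProcess.
Context {R : realType} {X : Type} (kappa : X -> X -> R).

Definition gram t (a : 'I_t -> X) : 'M[R]_t := \matrix_(i, j) kappa (a i) (a j).

Definition kvec t (a : 'I_t -> X) (x : X) : 'cV[R]_t := \col_i kappa x (a i).

Definition post_mean (zeta : R) t (a : 'I_t -> X) (y : 'I_t -> R) (x : X) : R :=
  ((kvec a x)^T *m invmx (gram a + zeta%:M) *m \col_i y i) 0 0.

Definition post_var (zeta : R) t (a : 'I_t -> X) (x : X) : R :=
  kappa x x - ((kvec a x)^T *m invmx (gram a + zeta%:M) *m kvec a x) 0 0.

Definition info_gain (zeta : R) t (a : 'I_t -> X) : R :=
  2^-1 * ln (\det (1%:M + zeta^-1 *: gram a)).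

(* [sup] is meaningful only if the set of information gains is bounded. *)
Definition max_info_gain (zeta : R) (t : nat) : R :=
  sup [set info_gain zeta a | a in [set: 'I_t -> X]].

Definition max_info_gain_finite (zeta : R) (t : nat) : Prop :=
  has_ubound [set info_gain zeta a | a in [set: 'I_t -> X]].

End GaussianProcess.

Definition is_argmax (R : realType) (X : Type) (f : X -> R) (x : X) : Prop :=
  forall x', f x' <= f x.

Definition gp_zeta (R : realType) (T : nat) : R := 1 + 2 / T%:R.

Definition igp_ucb_beta (R : realType) (Bnorm Rsub delta gamma : R) : R :=
  Bnorm + Rsub * Num.sqrt (2 * (gamma + 1 + ln (1 / delta))).

(* Queries and errors are indexed from 0: [x s], [eps s] are the paper's
   x_(s+1), epsilon_(s+1).  This is the sigma-algebra generated by the queries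
   up to and including the one of iteration [s] and by the earlier errors. *)
Definition history d (Omega : measurableType d) dX (X : measurableType dX)
    (R : realType) (x : nat -> Omega -> X) (eps : nat -> Omega -> R) (s : nat) :
    set (set Omega) :=
  <<s (\bigcup_(i in [set i | (i <= s)%N])
         preimage_set_system setT (x i) measurable) `|`
      (\bigcup_(i in [set i | (i < s)%N])
         preimage_set_system setT (eps i) measurable) >>.

(* E[exp(lambda eps) | G] <= exp(lambda^2 Rsub^2 / 2) almost surely, expressed
   by integration over the events of G; A = setT is the unconditional
   R-sub-Gaussian inequality. *)
Definition subgaussian_given d (Omega : measurableType d) (R : realType)
    (P : probability Omega R) (G : set (set Omega)) (eps : Omega -> R)
    (Rsub : R) : Prop :=
  forall (lambda : R) (A : set Omega), G A ->
    (\int[P]_(w in A) (expR (lambda * eps w))%:E <=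
     (expR (lambda ^+ 2 * Rsub ^+ 2 / 2))%:E * P A)%E.

(* Training steps spent on the [N] full runs and [T] BO iterations. *)
Definition jobs_cost (N B Bsmall T : nat) : nat :=
  (\sum_(i < N) B + \sum_(s < T) Bsmall)%N.

Definition jobs_exhausts (C N B Bsmall T : nat) : Prop :=
  (jobs_cost N B Bsmall T <= C < jobs_cost N B Bsmall T.+1)%N.

Section JoBS.
Context {R : realType} {X Omega W : Type}.
Variables (metric : W -> R) (theta : nat -> Omega -> X -> nat -> W).
Variables (N B Bsmall : nat).
Variables (design : 'I_N -> Omega -> X).
Variables (learn : ('I_N -> X * R * R) -> X -> R -> R).
Variables (x : nat -> Omega -> X).

(* [theta r w x b]: weights after [b] steps of the [r]-th training run of the
   algorithm when it uses configuration [x].  Runs 0..N-1 are the full runs;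
   run N + s is the short run of BO iteration [s]. *)
Definition predictor (w : Omega) : X -> R -> R :=
  learn (fun i => (design i w,
                   metric (theta i w (design i w) Bsmall),
                   metric (theta i w (design i w) B))).

Definition observation (s : nat) (w : Omega) : R :=
  predictor w (x s w) (metric (theta (N + s)%N w (x s w) Bsmall)).

Definition prediction_error (L : X -> R) (s : nat) (w : Omega) : R :=
  observation s w - L (x s w).

Definition ucb (kappa : X -> X -> R) (zeta Bnorm Rsub delta : R)
    (s : nat) (w : Omega) (x' : X) : R :=
  let a := fun i : 'I_s => x i w in
  let y := fun i : 'I_s => observation i w in
  post_mean kappa zeta a y x' +
  igp_ucb_beta Bnorm Rsub delta (max_info_gain kappa zeta s) *
    Num.sqrt (post_var kappa zeta a x').

Definition avg_regret (L : X -> R) (xstar : X) (T : nat) (w : Omega) : R :=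
  T%:R^-1 * \sum_(s < T) (L xstar - L (x s w)).

End JoBS.

(* Main.v *)
(* The observation errors are handled by the method of mixtures: averaging the
   exponential martingales exp(sum_i lambda_i e_i - lambda_i^2 / 2) over a
   Gaussian vector lambda of covariance K + (zeta - 1) I gives the likelihood
   ratio exp((e^T (I - (K + zeta I)^-1) e - ln det (K + zeta I)) / 2).  Given the
   past and the current query, the coordinate lambda_t is Gaussian with the
   posterior mean and variance of the process, so this ratio is a
   supermartingale, and Ville's inequality bounds the noise energy
   e^T (I - (K + zeta I)^-1) e uniformly in time.  In the RKHS that energy
   controls |mu_t - L| by sigma_t times the exploration coefficient, so a UCB
   step has regret at most 2 beta_T sigma_t.  The sum of the sigma_t^2 is at most
   a multiple of gamma_T because the information gain is
   1/2 sum_t ln(1 + sigma_t^2 / zeta), and finiteness of the information gain of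
   one point bounds the kernel on the diagonal.  Unless kappa vanishes on the
   diagonal (then L = 0), gamma_T is bounded below by a constant depending only
   on kappa, which absorbs the additive 1 in beta_T. *)
Require Import Defs.
From mathcomp Require Import all_boot all_order all_algebra.
From mathcomp Require Import all_classical all_reals all_analysis.
From mathcomp Require Import sesquilinear measurable_realfun zify ring lra.
Import Order.TTheory GRing.Theory Num.Theory.
Import numFieldNormedType.Exports.

Set Implicit Arguments.
Unset Strict Implicit.
Unset Printing Implicit Defensive.

Local Open Scope classical_set_scope.
Local Open Scope ring_scope.

(** * Hilbert space geometry of the kernel sections *)

Section Rkhs.
Context {R : realType} {X : Type} (kappa : X -> X -> R) (H : rkhs kappa).
Local Notation dot := (rkhs_dot H).
Local Notation phi := (rkhs_section H).

Lemma dotC (f g : H) : dot f g = dot g f.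
Proof. by have := @hermC _ _ _ _ dot f g; rewrite /= expr0 mul1r. Qed.

Lemma dot_ge0 (f : H) : 0 <= dot f f.
Proof. by rewrite rkhs_normE exprn_ge0. Qed.

Lemma kernelE (x y : X) : kappa x y = dot (phi x) (phi y).
Proof. by rewrite -rkhs_reproducing rkhs_sectionE. Qed.

Lemma kernelC (x y : X) : kappa x y = kappa y x.
Proof. by rewrite !kernelE dotC. Qed.

Lemma kernel_ge0 (x : X) : 0 <= kappa x x.
Proof. by rewrite kernelE dot_ge0. Qed.

(** The square norm of <g,g> f - <f,g> g equals <g,g> times the gap of the two sides. If <g,g> = 0
    then g = 0, because the norm comes from the dot product. *)
Lemma dot_CauchySchwarz (f g : H) : dot f g ^+ 2 <= dot f f * dot g g.
Proof.
have [g0|g_neq0] := eqVneq (dot g g) 0.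
  have : g = 0 by apply/normr0_eq0/eqP; rewrite -sqrf_eq0 -(rkhs_normE (r:=H)) g0.
  by move=> ->; rewrite !linear0r expr0n.
have g_gt0 : 0 < dot g g by rewrite lt_neqAle eq_sym g_neq0 dot_ge0.
have := dot_ge0 (dot g g *: f - dot f g *: g).
rewrite linearBl !linearBr /= !linearZl_LR !linearZr_LR /= /GRing.scale /= (dotC g f) => h.
have : 0 <= dot g g * (dot f f * dot g g - dot f g ^+ 2) by lra.
by rewrite pmulr_rge0 // subr_ge0.
Qed.


Lemma sum_CauchySchwarz t (u v : 'cV[R]_t) :
  (\sum_i u i 0 * v i 0) ^+ 2 <= (\sum_i u i 0 ^+ 2) * \sum_i v i 0 ^+ 2.
Proof.
set b := \sum_i u i 0 * v i 0; set c := \sum_i v i 0 ^+ 2.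
have c_ge0 : 0 <= c by apply: sumr_ge0 => i _; exact: sqr_ge0.
have h l m : 0 <= l ^+ 2 * (\sum_i u i 0 ^+ 2) - 2 * l * m * b + m ^+ 2 * c.
  have -> : l ^+ 2 * (\sum_i u i 0 ^+ 2) - 2 * l * m * b + m ^+ 2 * c =
            \sum_i (l * u i 0 - m * v i 0) ^+ 2.
    rewrite /b /c !mulr_sumr -sumrB -big_split; apply: eq_bigr => i _ /=; ring.
  by apply: sumr_ge0 => i _; exact: sqr_ge0.
have [c0|c_neq0] := eqVneq c 0.
  have v0 i : v i 0 = 0.
    apply/eqP; rewrite -sqrf_eq0; move/eqP: c0.
    by rewrite psumr_eq0 => [/allP/(_ i)|j _]; [apply; rewrite mem_index_enum|exact: sqr_ge0].
  by rewrite /b c0 mulr0 big1 ?expr0n// => i _; rewrite v0 mulr0.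
have c_gt0 : 0 < c by rewrite lt_neqAle eq_sym c_neq0.
(* The quadratic form [h] at l = c, m = b is c times the gap. *)
have : 0 <= c * ((\sum_i u i 0 ^+ 2) * c - b ^+ 2).
  by have := h c b; lra.
by rewrite pmulr_rge0 // subr_ge0.
Qed.

(** * Kernel ridge regression at finitely many points *)

Section Regression.
Variables (zeta : R) (zeta_gt0 : 0 < zeta).
Variables (t : nat) (a : 'I_t -> X).
Local Notation A := (gram kappa a + zeta%:M).

(** Adjoint of evaluation at the points [a]; the Gram matrix is the RKHS form pulled back along
    it. *)
Definition comb (u : 'cV[R]_t) : H := \sum_i u i 0 *: phi (a i).

Lemma dot_combl (u : 'cV[R]_t) (f : H) :
  dot (comb u) f = \sum_i u i 0 * dot (phi (a i)) f.
Proof.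
by rewrite linear_sumlz; apply: eq_bigr => i _; rewrite linearZl_LR.
Qed.

Lemma gram_mulE (u : 'cV[R]_t) i : (gram kappa a *m u) i 0 = dot (comb u) (phi (a i)).
Proof.
rewrite mxE dot_combl; apply: eq_bigr => j _.
by rewrite mxE kernelE mulrC (dotC (phi (a j))).
Qed.

Lemma gram_quadE (u v : 'cV[R]_t) :
  \sum_i v i 0 * (gram kappa a *m u) i 0 = dot (comb v) (comb u).
Proof.
rewrite dot_combl; apply: eq_bigr => i _.
by rewrite gram_mulE (dotC (comb u)).
Qed.

Lemma regularized_mulE (u : 'cV[R]_t) i :
  (A *m u) i 0 = dot (comb u) (phi (a i)) + zeta * u i 0.
Proof. by rewrite mulmxDl mul_scalar_mx [LHS]mxE gram_mulE [in X in _ + X]mxE. Qed.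

Lemma regularized_sym : A^T = A.
Proof.
apply/matrixP => i j; rewrite !mxE kernelC.
by rewrite [j == i]eq_sym.
Qed.

(** A null vector v satisfies |comb v|^2 + zeta |v|^2 = 0, hence vanishes since zeta > 0. *)
Lemma regularized_unit : A \in unitmx.
Proof.
rewrite -row_free_unit; apply: inj_row_free => v vA0.
have Av0 : A *m v^T = 0 by rewrite -regularized_sym -trmx_mul vA0 trmx0.
have h : dot (comb v^T) (comb v^T) + zeta * \sum_i v^T i 0 ^+ 2 = 0.
  rewrite [X in X + _]dot_combl mulr_sumr -big_split big1//= => i _.
  have := regularized_mulE v^T i; rewrite Av0 mxE => h.
  rewrite (dotC (phi (a i))).
  by rewrite -[RHS](mulr0 (v^T i 0)) h; ring.
have s_ge0 : 0 <= \sum_i v^T i 0 ^+ 2 by apply: sumr_ge0 => i _; exact: sqr_ge0.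
have s0 : \sum_i v^T i 0 ^+ 2 = 0.
  have := dot_ge0 (comb v^T) => h1.
  by apply/eqP; rewrite eq_le s_ge0 andbT -(pmulr_rle0 _ zeta_gt0); lra.
apply/rowP => i; rewrite mxE; apply/eqP; rewrite -sqrf_eq0.
move/eqP: s0; rewrite psumr_eq0; last by move=> j _; exact: sqr_ge0.
by move=> /allP/(_ i); rewrite mem_index_enum mxE; apply.
Qed.

(** Ridge regression coefficients: the posterior mean at [x] is the combination of the observations
    with these weights. *)
Definition weights (x : X) : 'cV[R]_t := invmx A *m kvec kappa a x.

Lemma weightsE (x : X) i :
  dot (comb (weights x)) (phi (a i)) + zeta * weights x i 0 = kappa x (a i).
Proof. by rewrite -regularized_mulE mulKVmx ?regularized_unit// mxE. Qed.

Lemma kvec_invE (x : X) (v : 'cV[R]_t) :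
  ((kvec kappa a x)^T *m invmx A *m v) 0 0 = \sum_i weights x i 0 * v i 0.
Proof.
have -> : (kvec kappa a x)^T *m invmx A = (weights x)^T.
  by rewrite trmx_mul trmx_inv regularized_sym.
by rewrite mxE; apply: eq_bigr => i _; rewrite mxE.
Qed.

Lemma post_meanE (y : 'I_t -> R) (x : X) :
  post_mean kappa zeta a y x = \sum_i weights x i 0 * y i.
Proof. by rewrite /post_mean kvec_invE; apply: eq_bigr => i _; rewrite mxE. Qed.

Definition residual (x : X) : H := phi x - comb (weights x).

(** Normal equation of the ridge problem that approximates [phi x] by sections at the points [a]. *)
Lemma dot_residual (x : X) i : dot (residual x) (phi (a i)) = zeta * weights x i 0.
Proof. by rewrite linearBl /= -kernelE -(weightsE x i) addrC addKr. Qed.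

(** The posterior variance is the value of the ridge objective at its minimizer; this displays it as
    a squared norm in H plus R^t. *)
Lemma post_varE (x : X) :
  post_var kappa zeta a x =
  dot (residual x) (residual x) + zeta * \sum_i weights x i 0 ^+ 2.
Proof.
rewrite /post_var kvec_invE {2}/residual linearBr /= {1}/residual linearBl /= -kernelE.
rewrite -!addrA; congr (_ + _).
rewrite (dotC (residual x)) [dot (comb _) (residual _)]dot_combl.
rewrite mulr_sumr dot_combl -!sumrN -!big_split /=; apply: eq_bigr => i _.
rewrite [dot (phi (a i)) (residual x)]dotC dot_residual [kvec _ _ _ _ _]mxE (dotC (phi (a i))) -kernelE.
ring.
Qed.

Lemma post_var_ge0 (x : X) : 0 <= post_var kappa zeta a x.
Proof.
rewrite post_varE addr_ge0 ?dot_ge0// mulr_ge0 ?(ltW zeta_gt0)// sumr_ge0// => i _.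
exact: sqr_ge0.
Qed.

(** The subtracted term is w^T (K + zeta I) w for w the weights, that is |comb w|^2 + zeta |w|^2. *)
Lemma post_var_le (x : X) : post_var kappa zeta a x <= kappa x x.
Proof.
have : 0 <= dot (comb (weights x)) (comb (weights x)) + zeta * \sum_i weights x i 0 ^+ 2.
  rewrite addr_ge0 ?dot_ge0// mulr_ge0 ?(ltW zeta_gt0)// sumr_ge0// => i _.
  exact: sqr_ge0.
rewrite /post_var kvec_invE lerBlDr lerDl dot_combl mulr_sumr -big_split /=.
congr (_ <= _); apply: eq_bigr => i _.
by rewrite [kvec _ _ _ _ _]mxE -(weightsE x i) (dotC (phi (a i))); ring.
Qed.

(* The squared norm of the noise in the metric I - (K + zeta I)^-1. *)
Definition noise_energy (e : 'I_t -> R) : R :=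
  \sum_i e i ^+ 2 - \sum_i e i * (invmx A *m \col_j e j) i 0.

(** With u = (K + zeta I)^-1 e, the normal equation turns the left sum into <residual, comb u> + <w,
    K u>. Cauchy-Schwarz on each term, weighted by zeta, pairs the two parts of the posterior
    variance with |comb u|^2 and |K u|^2 / zeta. *)
Lemma weights_noise (zeta_ge1 : 1 <= zeta) (e : 'I_t -> R) (x : X) :
  (\sum_i weights x i 0 * e i) ^+ 2 <= post_var kappa zeta a x * noise_energy e.
Proof.
pose u : 'cV[R]_t := invmx A *m \col_j e j.
have eE i : e i = dot (comb u) (phi (a i)) + zeta * u i 0.
  by rewrite -regularized_mulE mulKVmx ?regularized_unit// mxE.
pose Ku : 'cV[R]_t := gram kappa a *m u.
have KuE i : dot (comb u) (phi (a i)) = Ku i 0 by rewrite gram_mulE.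
set g2 := dot (comb u) (comb u).
have g2E : g2 = \sum_i u i 0 * Ku i 0 by rewrite /g2 -gram_quadE.
have lhsE : \sum_i weights x i 0 * e i =
    dot (residual x) (comb u) + \sum_i weights x i 0 * Ku i 0.
  rewrite (dotC (residual x)) dot_combl -big_split /=; apply: eq_bigr => i _.
  by rewrite (dotC (phi (a i))) dot_residual eE KuE; ring.
set s2 := \sum_i Ku i 0 ^+ 2.
have energyE : noise_energy e =
    s2 + (2 * zeta - 1) * g2 + (zeta ^+ 2 - zeta) * \sum_i u i 0 ^+ 2.
  rewrite /noise_energy -/u g2E /s2 !mulr_sumr -sumrB -!big_split /=.
  by apply: eq_bigr => i _; rewrite eE KuE; ring.
have g2_ge0 : 0 <= g2 by exact: dot_ge0.
have u2_ge0 : 0 <= \sum_i u i 0 ^+ 2 by apply: sumr_ge0 => i _; exact: sqr_ge0.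
have s2_ge0 : 0 <= s2 by apply: sumr_ge0 => i _; exact: sqr_ge0.
(* Here zeta >= 1 enters: it makes the discarded terms of [energyE] nonnegative. *)
have energy_ge : g2 + s2 / zeta <= noise_energy e.
  rewrite energyE.
  have : s2 / zeta <= s2 by rewrite ler_pdivrMr// ler_peMr.
  have : 0 <= (2 * zeta - 2) * g2 by rewrite mulr_ge0//; lra.
  have : 0 <= (zeta ^+ 2 - zeta) * \sum_i u i 0 ^+ 2.
    by apply: mulr_ge0 => //; nra.
  lra.
apply: le_trans (ler_wpM2l (post_var_ge0 x) energy_ge).
rewrite lhsE post_varE.
set p := dot _ _; set q := \sum_i _ * _; set r := dot _ _; set w := \sum_i _ ^+ 2.
have pr : p ^+ 2 <= r * g2 by exact: dot_CauchySchwarz.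
have qw : q ^+ 2 <= w * s2 by exact: sum_CauchySchwarz.
have r_ge0 : 0 <= r by exact: dot_ge0.
have w_ge0 : 0 <= w by apply: sumr_ge0 => i _; exact: sqr_ge0.
(* AM-GM: (p q)^2 <= m n gives 2 p q <= m + n. *)
have cross : 2 * (p * q) <= r * (s2 / zeta) + zeta * w * g2.
  set m := r * _; set n := zeta * w * g2.
  have m_ge0 : 0 <= m by rewrite /m !mulr_ge0// invr_ge0 ltW.
  have n_ge0 : 0 <= n by rewrite /n !mulr_ge0// ltW.
  have pq : (p * q) ^+ 2 <= m * n.
    have -> : m * n = (r * g2) * (w * s2) by rewrite /m /n; field; rewrite gt_eqF.
    by rewrite exprMn ler_pM ?sqr_ge0.
  have := sqr_ge0 (m - n) => mn.
  rewrite -[leRHS]ger0_norm ?addr_ge0//; apply: le_trans (ler_norm _) _.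
  rewrite -ler_sqr ?nnegrE ?normr_ge0 ?addr_ge0// real_normK ?num_real//.
  rewrite [`|m + n|]ger0_norm ?addr_ge0// exprMn.
  by move: pq mn; clearbody m n; lra.
have -> : (r + zeta * w) * (g2 + s2 / zeta) =
    r * g2 + (r * (s2 / zeta) + zeta * w * g2) + w * s2.
  by field; rewrite gt_eqF.
rewrite sqrrD -mulr_natl; lra.
Qed.

(** The error splits into the weighted noise and the bias -<f, residual>; the squared norm of the
    residual is at most the posterior variance. *)
Lemma post_mean_error (zeta_ge1 : 1 <= zeta) (f : H) (Bnorm : R) (e : 'I_t -> R) (x : X) :
  Num.sqrt (dot f f) <= Bnorm ->
  `|post_mean kappa zeta a (fun i => rkhs_fun f (a i) + e i) x - rkhs_fun f x| <=
  (Bnorm + Num.sqrt (noise_energy e)) * Num.sqrt (post_var kappa zeta a x).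
Proof.
move=> fB.
have -> : post_mean kappa zeta a (fun i => rkhs_fun f (a i) + e i) x - rkhs_fun f x =
    \sum_i weights x i 0 * e i - dot f (residual x).
  rewrite post_meanE linearBr /= -rkhs_reproducing (dotC f (comb _)) dot_combl.
  rewrite opprB addrA; congr (_ - _).
  rewrite addrC -big_split /=; apply: eq_bigr => i _.
  by rewrite mulrDr rkhs_reproducing (dotC f).
have sq (p q : R) : p ^+ 2 <= q -> `|p| <= Num.sqrt q.
  by move=> pq; rewrite -sqrtr_sqr ler_wsqrtr.
have h1 : `|dot f (residual x)| <= Bnorm * Num.sqrt (post_var kappa zeta a x).
  apply: le_trans (sq _ _ (dot_CauchySchwarz _ _)) _.
  rewrite sqrtrM ?dot_ge0// ler_pM ?sqrtr_ge0// ler_wsqrtr// post_varE lerDl.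
  by rewrite mulr_ge0 ?(ltW zeta_gt0)// sumr_ge0// => i _; exact: sqr_ge0.
have h2 := sq _ _ (weights_noise zeta_ge1 e x).
rewrite sqrtrM ?post_var_ge0// in h2.
apply: le_trans (ler_normB _ _) _; rewrite mulrDl addrC lerD//.
by rewrite mulrC.
Qed.

End Regression.
End Rkhs.

(** * Recursions in the number of observations *)

Section Online.
Context {R : realType} {X : Type} (kappa : X -> X -> R) (H : rkhs kappa).
Variables (zeta : R) (zeta_gt0 : 0 < zeta) (a : nat -> X).
Local Notation pre t := (fun i : 'I_t => a i).
Local Notation A t := (gram kappa (pre t) + zeta%:M).
Local Notation unitA t := (regularized_unit H zeta_gt0 (pre t)).

(** Predictive variance of the next noisy observation; it is the Schur complement of [A t] in
    [A t.+1]. *)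
Definition pred_var t := zeta + post_var kappa zeta (pre t) (a t).

Lemma pred_var_gt0 t : 0 < pred_var t.
Proof. by rewrite ltr_pwDl // (post_var_ge0 H). Qed.

Lemma sum_ord_last t (F : 'I_t.+1 -> R) :
  \sum_i F i = \sum_i F (lift ord_max i) + F ord_max.
Proof. by rewrite (bigD1_ord ord_max) //= addrC. Qed.

(** Block elimination of the last point: [c] is the innovation divided by the pivot, and the earlier
    coordinates are corrected by [c] times the weights. The candidate solution is verified by
    multiplying it by the matrix. *)
Lemma regularized_last t (e : nat -> R) :
  let c := (e t - post_mean kappa zeta (pre t) (fun i => e i) (a t)) / pred_var t in
  invmx (A t.+1) *m \col_(j < t.+1) e j =
  \col_i oapp (fun j => (invmx (A t) *m \col_(j < t) e j) j 0
                        - c * weights kappa zeta (pre t) (a t) j 0) c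
              (unlift ord_max i).
Proof.
move=> c; rewrite -[RHS](mulKmx (unitA t.+1)); congr (_ *m _).
set u := invmx (A t) *m _; set w := weights _ _ _ _.
have uE (i : 'I_t) : \sum_(j < t) kappa (a i) (a j) * u j 0 + zeta * u i 0 = e i.
  have := mulKVmx (unitA t) (\col_(j < t) e j); rewrite -/u => /matrixP/(_ i 0).
  rewrite mulmxDl mul_scalar_mx !mxE => <-; congr (_ + _).
  by apply: eq_bigr => j _; rewrite !mxE.
have wE (i : 'I_t) : \sum_(j < t) kappa (a i) (a j) * w j 0 + zeta * w i 0 = kappa (a t) (a i).
  have := mulKVmx (unitA t) (kvec kappa (pre t) (a t)); rewrite -/(weights _ _ _ _) -/w.
  move=> /matrixP/(_ i 0).
  rewrite mulmxDl mul_scalar_mx !mxE => <-; congr (_ + _).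
  by apply: eq_bigr => j _; rewrite !mxE.
apply/colP => i; rewrite mulmxDl mul_scalar_mx ![in RHS]mxE mxE.
rewrite sum_ord_last.
under eq_bigr => j _ do rewrite !mxE liftK !lift_max /=.
rewrite !mxE unlift_none /=.
case: (unliftP ord_max i) => [j|] ->; rewrite ?lift_max /=.
- rewrite -(uE j).
  under [in RHS]eq_bigr => l _ do rewrite mulrBr mulrCA.
  rewrite sumrB -mulr_sumr (kernelC H (a j) (a t)) -(wE j); ring.
(* Last row: the diagonal entry is the pivot plus what elimination removes. *)
- have sE : zeta + kappa (a t) (a t) = pred_var t + \sum_(j < t) w j 0 * kappa (a t) (a j).
    rewrite /pred_var /post_var (kvec_invE H).
    under eq_bigr => j _ do rewrite [kvec _ _ _ _ _]mxE.
    by rewrite addrA subrK.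
  have mE : \sum_(j < t) kappa (a t) (a j) * u j 0 =
            post_mean kappa zeta (pre t) (fun i => e i) (a t).
    rewrite /post_mean -mulmxA mxE; apply: eq_bigr => j _.
    by rewrite !mxE.
  under eq_bigr => l _ do rewrite mulrBr mulrCA (mulrC _ (w _ _)).
  rewrite sumrB -mulr_sumr mE.
  have cE : c * pred_var t = e t - post_mean kappa zeta (pre t) (fun i => e i) (a t).
    by rewrite divfK ?gt_eqF ?pred_var_gt0.
  have -> : e t = c * pred_var t + post_mean kappa zeta (pre t) (fun i => e i) (a t).
    by rewrite cE subrK.
  have := congr1 ( *%R c) sE; rewrite !mulrDr => h.
  set S := \sum_l _ in h *.
  set m := post_mean _ _ _ _ _ in cE *.
  by transitivity (m - c * S + (c * zeta + c * kappa (a t) (a t))); [rewrite h; ring|ring].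
Qed.

Lemma noise_energyS t (e : nat -> R) :
  noise_energy kappa zeta (pre t.+1) (fun i => e i) =
  noise_energy kappa zeta (pre t) (fun i => e i) + e t ^+ 2
  - (e t - post_mean kappa zeta (pre t) (fun i => e i) (a t)) ^+ 2 / pred_var t.
Proof.
rewrite /noise_energy regularized_last.
set c := (_ - _) / _; set u := invmx (A t) *m _; set w := weights _ _ _ _.
rewrite big_ord_recr /= [X in _ - X]sum_ord_last.
under [X in _ - (X + _)]eq_bigr => j _
  do rewrite mxE liftK lift_max /= mulrBr mulrCA (mulrC (e j) (w _ _)).
rewrite sumrB -mulr_sumr mxE unlift_none /=.
have mE : post_mean kappa zeta (pre t) (fun i => e i) (a t) = \sum_(i < t) w i 0 * e i.
  by rewrite (post_meanE H).
rewrite -mE /c; set m := post_mean _ _ _ _ _.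
by field; rewrite gt_eqF ?pred_var_gt0.
Qed.

(** The last diagonal entry of the inverse is 1 / pred_var t by block elimination, and det (A t) /
    det (A t.+1) by the cofactor formula. *)
Lemma regularized_detS t : \det (A t.+1) = \det (A t) * pred_var t.
Proof.
(* The last basis vector, so that the product with the inverse reads off its last column. *)
pose e (i : nat) : R := (i == t)%:R.
have det_neq0 : \det (A t.+1) != 0.
  by rewrite -unitfE -unitmxE (unitA t.+1).
have m0 : post_mean kappa zeta (pre t) (fun i => e i) (a t) = 0.
  by rewrite (post_meanE H) big1// => i _; rewrite /e ltn_eqF// mulr0.
have := congr1 (fun M : 'cV[R]_t.+1 => M ord_max 0) (regularized_last t e).
rewrite m0 /= subr0 [in RHS]mxE unlift_none /= [in RHS]/e eqxx mul1r.
rewrite /invmx (unitA t.+1) mxE (bigD1 ord_max)//= big1 ?addr0; last first.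
  move=> i i_neq; rewrite [X in _ * X]mxE /e.
  by rewrite (_ : (i == t :> nat) = false) ?mulr0//; apply/negbTE.
rewrite !mxE /e eqxx mulr1 /cofactor /= addnn -signr_odd odd_double expr0 mul1r.
have -> : row' ord_max (col' ord_max (A t.+1)) = A t.
  by apply/matrixP => i j; rewrite !mxE !lift_max (inj_eq (@lift_inj _ _)).
have := pred_var_gt0 t => s_gt0 h.
apply: (mulfI (invr_neq0 det_neq0)); rewrite mulVf// mulrA h mulVf//.
by rewrite gt_eqF.
Qed.

Lemma regularized_detE t : \det (A t) = \prod_(i < t) pred_var i.
Proof.
elim: t => [|t IH]; first by rewrite det_mx00 big_ord0.
by rewrite regularized_detS big_ord_recr IH.
Qed.

(** Chain rule for mutual information: the determinant factors into the predictive variances. *)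
Lemma info_gainE t :
  info_gain kappa zeta (pre t) =
  2^-1 * \sum_(s < t) ln (1 + post_var kappa zeta (pre s) (a s) / zeta).
Proof.
rewrite /info_gain.
have -> : 1%:M + zeta^-1 *: gram kappa (pre t) = zeta^-1 *: A t.
  by rewrite scalerDr scale_scalar_mx mulVf ?gt_eqF// addrC.
rewrite detZ regularized_detE; congr (_ * _).
elim: t => [|t IH]; first by rewrite !big_ord0 expr0 mul1r ln1.
rewrite !big_ord_recr /= -IH -lnM ?posrE; last first.
- by rewrite ltr_pwDl// divr_ge0 ?(post_var_ge0 H) ?ltW.
- rewrite mulr_gt0 ?exprn_gt0 ?invr_gt0// prodr_gt0// => i _; exact: pred_var_gt0.
congr ln; rewrite exprSr -!mulrA; congr (_ * _); rewrite mulrCA; congr (_ * _).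
by rewrite /pred_var; field; rewrite gt_eqF.
Qed.

End Online.

(** * Measurability of inverses and determinants *)

Section Measurability.
Context d (T : measurableType d) (R : realType).

Lemma measurable_fun_inv_gt0 (f : T -> R) :
  (forall w, 0 < f w) -> measurable_fun setT f ->
  measurable_fun setT (fun w => (f w)^-1).
Proof.
move=> f_gt0 mf.
have -> : (fun w => (f w)^-1) = expR \o (fun w => - ln (f w)).
  by apply/funext => w /=; rewrite expRN lnK// posrE.
apply: measurableT_comp => //; apply: measurable_funN.
exact: measurableT_comp (@measurable_ln R) mf.
Qed.

Lemma measurable_fun_det n (M : T -> 'M[R]_n) :
  (forall i j, measurable_fun setT (fun w => M w i j)) ->
  measurable_fun setT (fun w => \det (M w)).
Proof.
move=> mM; apply: measurable_sum => s; apply: measurable_funM => //.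
by apply: measurable_prod => i _; exact: mM.
Qed.

End Measurability.

(** * Exponential tilting of a normal density *)

Section GaussianMixture.
Context {R : realType}.
Local Notation mu := (@lebesgue_measure R).

(** Normal density of mean [m] and variance [v]; the normalization sits in the exponent, so that
    tilting is an identity between exponents. *)
Definition gauss_pdf (m v x : R) : R :=
  expR (- ((x - m) ^+ 2 / (2 * v)) - ln (2 * pi * v) / 2).

Lemma integral_gauss_pdf (m v : R) : 0 < v ->
  (\int[mu]_x (gauss_pdf m v x)%:E = 1)%E.
Proof.
move=> v_gt0; have sv_neq0 : Num.sqrt v != 0 by rewrite gt_eqF ?sqrtr_gt0.
rewrite -(integral_normal_pdf m (Num.sqrt v)); apply: eq_integral => x _.
rewrite normal_pdfE// /normal_peak /normal_fun sqr_sqrtr ?ltW//.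
have vpi_gt0 : 0 < v * pi *+ 2 by rewrite pmulrn_lgt0// mulr_gt0// pi_gt0.
have -> : (Num.sqrt (v * pi *+ 2))^-1 = expR (- (ln (v * pi *+ 2) / 2)).
  rewrite expRN; congr (_^-1); apply/eqP.
  rewrite -(@eqrXn2 _ 2) ?sqrtr_ge0 ?expR_ge0// sqr_sqrtr ?ltW//.
  by rewrite -expRM_natl [2%:R * _]mulrC divfK ?lnK ?posrE// pnatr_eq0.
rewrite -expRD /gauss_pdf; congr ((expR _)%:E).
have -> : v * pi *+ 2 = 2 * pi * v by rewrite -mulr_natl; ring.
by rewrite -(mulr_natl v 2); field; rewrite gt_eqF.
Qed.

(** Completing the square: the tilt adds 1 to the precision 1 / v. The factor left over is the
    one-step likelihood ratio. *)
Lemma gauss_pdf_tilt (e m v x : R) : 0 < v ->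
  expR (x * e - x ^+ 2 / 2) * gauss_pdf m v x =
  expR ((e ^+ 2 - (e - m) ^+ 2 / (1 + v) - ln (1 + v)) / 2) *
  gauss_pdf ((v * e + m) / (1 + v)) (v / (1 + v)) x.
Proof.
move=> v_gt0; have v1_gt0 : 0 < 1 + v by rewrite addr_gt0.
rewrite /gauss_pdf -!expRD; congr expR.
have -> : ln (2 * pi * (v / (1 + v))) = ln (2 * pi * v) - ln (1 + v).
  by rewrite mulrA ln_div ?posrE// !mulr_gt0// pi_gt0.
by field; rewrite !gt_eqF.
Qed.

Lemma integral_gauss_pdf_tilt (e m v : R) : 0 < v ->
  (\int[mu]_x (expR (x * e - x ^+ 2 / 2) * gauss_pdf m v x)%:E =
   (expR ((e ^+ 2 - (e - m) ^+ 2 / (1 + v) - ln (1 + v)) / 2))%:E)%E.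
Proof.
move=> v_gt0; under eq_integral do rewrite gauss_pdf_tilt// EFinM.
have v1_gt0 : 0 < 1 + v by rewrite addr_gt0.
rewrite ge0_integralZl_EFin ?expR_ge0//.
- by rewrite integral_gauss_pdf ?mule1// divr_gt0.
- by move=> x _; rewrite lee_fin expR_ge0.
apply/measurable_EFinP; apply: measurableT_comp => //.
apply: measurable_funB => //; apply: measurable_funN.
apply: measurable_funM => //; apply: measurable_funX; exact: measurable_funB.
Qed.

Lemma measurable_gauss_pdf d (T : measurableType d) (m v x : T -> R) :
  (forall w, 0 < v w) -> measurable_fun setT m -> measurable_fun setT v ->
  measurable_fun setT x ->
  measurable_fun setT (fun w => gauss_pdf (m w) (v w) (x w)).
Proof.
move=> v_gt0 mm mv mx; apply: measurableT_comp => //.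
apply: measurable_funB.
  apply: measurable_funN; apply: measurable_funM.
    by apply: measurable_funX; exact: measurable_funB.
  apply: measurable_fun_inv_gt0 => [w|]; first by rewrite mulr_gt0.
  exact: measurable_funM.
apply: measurable_funM => //; apply: measurableT_comp (@measurable_ln R) _.
exact: measurable_funM.
Qed.

End GaussianMixture.

(** * From sub-Gaussian bounds on events to mixtures with random weights *)

Section SubGaussian.
Context d (Omega : measurableType d) (R : realType) (P : probability Omega R).
Local Notation mu := (@lebesgue_measure R).

(** Z is the integral over u of the indicator of 0 <= u < Z, and Tonelli exchanges the integrals.
    This reduces integrals weighted by Z to integrals over events. *)
Lemma layer_cake (Z f : Omega -> R) :
  (forall w, 0 <= Z w) -> (forall w, 0 <= f w) ->
  measurable_fun setT Z -> measurable_fun setT f ->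
  measurable_fun setT
    (fun u : R => (\int[P]_(w in [set w | (0 <= u < Z w)%R]) (f w)%:E)%E) /\
  (\int[P]_w (Z w * f w)%:E =
   \int[mu]_u \int[P]_(w in [set w | (0 <= u < Z w)%R]) (f w)%:E)%E.
Proof.
move=> Z_ge0 f_ge0 mZ mf.
pose F (z : Omega * R) : \bar R :=
  (\1_[set z : Omega * R | 0 <= z.2 < Z z.1] z * f z.1)%:E.
have mA : measurable [set z : Omega * R | 0 <= z.2 < Z z.1].
  rewrite -[X in measurable X]setTI.
  have -> : [set z : Omega * R | 0 <= z.2 < Z z.1] =
            (fun z => (0 <= z.2) && (z.2 < Z z.1)) @^-1` [set true].
    by apply/seteqP; split.
  have : measurable_fun [set: Omega * R] (fun z => (0 <= z.2) && (z.2 < Z z.1)).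
    apply: measurable_and; first exact: measurable_fun_ler.
    by apply: measurable_fun_ltr => //; exact: measurableT_comp mZ _.
  by apply.
have mF : measurable_fun setT F.
  apply/measurable_EFinP; apply: measurable_funM; first exact: measurable_indic.
  exact: measurableT_comp mf _.
have F_ge0 z : (0 <= F z)%E by rewrite lee_fin mulr_ge0.
have section u : (\int[P]_w F (w, u) =
    \int[P]_(w in [set w | (0 <= u < Z w)%R]) (f w)%:E)%E.
  rewrite [RHS]integral_mkcond; apply: eq_integral => w _.
  rewrite /F patchE indicE; have [h|h] := boolP (0 <= u < Z w).
    by rewrite !mem_set//= mul1r.
  by rewrite !memNset ?mul0r//=; exact/negP.
split.
  have -> : (fun u : R => (\int[P]_(w in [set w | (0 <= u < Z w)%R]) (f w)%:E)%E) =
            (fun u => (\int[P]_w F (w, u))%E) by apply/funext => u; rewrite section.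
  exact: measurable_fun_fubini_tonelli_G.
transitivity (\int[P]_w \int[mu]_u F (w, u))%E.
  apply: eq_integral => w _; rewrite /F /=.
  have -> : (fun u => (\1_[set z : Omega * R | 0 <= z.2 < Z z.1] (w, u) * f w)%:E) =
            (fun u => ((f w)%:E * (\1_(`[0, Z w[%classic) u)%:E)%E).
    apply/funext => u; rewrite mulrC EFinM; congr (_ * (_)%:E)%E.
  rewrite ge0_integralZl_EFin//; last by apply/measurable_EFinP; exact: measurable_indic.
  rewrite integral_indic//= setIT lebesgue_measure_itv /= lte_fin.
  case: ltP => [_|Z0]; first by rewrite oppr0 adde0 -EFinM mulrC.
  have -> : Z w = 0 by apply/eqP; rewrite eq_le Z0 Z_ge0.
  by rewrite mul0r mule0.
rewrite fubini_tonelli//; apply: eq_integral => u _; exact: section.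
Qed.

Variables (gens : set (set Omega)).
Hypothesis gens_meas : <<s gens >> `<=` @measurable _ Omega.
Local Notation sub := (g_sigma_algebraType gens).

Lemma measurable_fun_sub d' (T : measurableType d') (f : Omega -> T) :
  measurable_fun [set: sub] (f : sub -> T) -> measurable_fun [set: Omega] f.
Proof. by move=> mf _ B mB; apply: gens_meas; exact: mf. Qed.

(** The level sets of [Z] lie in the sub-sigma-algebra, where the hypothesis holds event by event;
    integrating over the level gives the weighted bound. *)
Lemma subgaussian_weighted (e : Omega -> R) (Rsub lambda : R) (Z : Omega -> R) :
  measurable_fun setT e -> subgaussian_given P <<s gens >> e Rsub ->
  (forall w, 0 <= Z w) -> measurable_fun [set: sub] (Z : sub -> R) ->
  (\int[P]_w (Z w * expR (lambda * e w))%:E <=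
   (expR (lambda ^+ 2 * Rsub ^+ 2 / 2))%:E * \int[P]_w (Z w)%:E)%E.
Proof.
move=> me sg Z_ge0 mZ; have mZ' := measurable_fun_sub mZ.
have mexp : measurable_fun setT (fun w => expR (lambda * e w)).
  by apply: measurableT_comp => //; exact: measurable_funM.
have Asub u : <<s gens >> [set w | 0 <= u < Z w].
  have [u_ge0|u_lt0] := leP 0 u; last first.
    by rewrite (_ : [set _ | _] = set0)//; [exact: (@measurable0 _ sub)|apply/seteqP; split].
  have -> : [set w | true && (u < Z w)] = (fun w : sub => u < Z w) @^-1` [set true].
    by apply/seteqP; split.
  rewrite -[X in <<s _ >> X]setTI.
  have : measurable_fun [set: sub] (fun w => u < Z w) by exact: measurable_fun_ltr.
  by apply.
have [m1 h1] := @layer_cake Z (cst 1) Z_ge0 (fun=> ler01) mZ' (measurable_cst _).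
have [m2 h2] := layer_cake Z_ge0 (fun w => expR_ge0 (lambda * e w)) mZ' mexp.
rewrite h2 (_ : \int[P]_w (Z w)%:E = \int[P]_w (Z w * 1)%:E)%E; last first.
  by apply: eq_integral => w _; rewrite mulr1.
rewrite h1 -ge0_integralZl_EFin ?expR_ge0//; last first.
  by move=> u _; apply: integral_ge0 => w _; rewrite lee_fin.
apply: ge0_le_integral => //.
- by move=> u _; apply: integral_ge0 => w _; rewrite lee_fin expR_ge0.
- exact: measurable_funeM.
- move=> u _; have := integral_cst P (gens_meas (Asub u)) 1%E.
  rewrite mul1e => /= ->; exact: sg (Asub u).
Qed.

(* Fubini: for each frequency [x] the sub-Gaussian inequality is weighted by the
   [sub]-measurable Gaussian density of [x], and the density integrates to 1. *)
Lemma subgaussian_mixture (e Z m v : Omega -> R) :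
  measurable_fun setT e -> subgaussian_given P <<s gens >> e 1 ->
  (forall w, 0 <= Z w) -> (forall w, 0 < v w) ->
  measurable_fun [set: sub] (Z : sub -> R) ->
  measurable_fun [set: sub] (m : sub -> R) ->
  measurable_fun [set: sub] (v : sub -> R) ->
  (\int[P]_w (Z w * expR ((e w ^+ 2 - (e w - m w) ^+ 2 / (1 + v w)
                          - ln (1 + v w)) / 2))%:E <=
   \int[P]_w (Z w)%:E)%E.
Proof.
move=> me sg Z_ge0 v_gt0 mZ mm mv.
pose g (z : Omega * R) := Z z.1 * gauss_pdf (m z.1) (v z.1) z.2.
have g_ge0 z : 0 <= g z by rewrite mulr_ge0 ?expR_ge0.
have mg : measurable_fun setT g.
  apply: measurable_funM; first exact: measurableT_comp (measurable_fun_sub mZ) _.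
  apply: measurable_gauss_pdf => //.
  - exact: measurableT_comp (measurable_fun_sub mm) _.
  - exact: measurableT_comp (measurable_fun_sub mv) _.
pose h (z : Omega * R) := g z * expR (z.2 * e z.1 - z.2 ^+ 2 / 2).
have mh : measurable_fun setT h.
  apply: measurable_funM => //; apply: measurableT_comp => //.
  apply: measurable_funB.
    by apply: measurable_funM => //; exact: measurableT_comp me _.
  by apply: measurable_funM => //; exact: measurable_funX.
have int_g w : (\int[mu]_x (g (w, x))%:E = (Z w)%:E)%E.
  rewrite /g /=; under eq_integral do rewrite EFinM.
  rewrite ge0_integralZl_EFin ?integral_gauss_pdf ?mule1//.
  - by move=> x _; rewrite lee_fin expR_ge0.
  - by apply/measurable_EFinP; exact: measurable_gauss_pdf.
have int_h w : (\int[mu]_x (h (w, x))%:E =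
   (Z w * expR ((e w ^+ 2 - (e w - m w) ^+ 2 / (1 + v w) - ln (1 + v w)) / 2))%:E)%E.
  rewrite /h /g /= EFinM -integral_gauss_pdf_tilt// -ge0_integralZl_EFin//.
  - by apply: eq_integral => x _; rewrite -EFinM; congr EFin; ring.
  - by move=> x _; rewrite lee_fin mulr_ge0 ?expR_ge0.
  - apply/measurable_EFinP; apply: measurable_funM; last exact: measurable_gauss_pdf.
    apply: measurableT_comp => //; apply: measurable_funB; first exact: measurable_funM.
    by apply: measurable_funM => //; exact: measurable_funX.
under eq_integral do rewrite -int_h.
under [leRHS]eq_integral do rewrite -int_g.
have mg' : measurable_fun setT (fun z => (g z)%:E) by exact/measurable_EFinP.
have mh' : measurable_fun setT (fun z => (h z)%:E) by exact/measurable_EFinP.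
have swap (k : Omega * R -> \bar R) : measurable_fun setT k -> (forall z, 0 <= k z)%E ->
    (\int[P]_w \int[mu]_x k (w, x) = \int[mu]_x \int[P]_w k (w, x))%E.
  by move=> mk k_ge0; rewrite fubini_tonelli.
have swap_h : (\int[P]_w \int[mu]_x (h (w, x))%:E = \int[mu]_x \int[P]_w (h (w, x))%:E)%E.
  by apply: (swap _ mh') => z; rewrite lee_fin mulr_ge0 ?expR_ge0.
have swap_g : (\int[P]_w \int[mu]_x (g (w, x))%:E = \int[mu]_x \int[P]_w (g (w, x))%:E)%E.
  by apply: (swap _ mg') => z; rewrite lee_fin.
rewrite swap_h swap_g.
apply: ge0_le_integral => //.
- by move=> x _; apply: integral_ge0 => w _; rewrite lee_fin mulr_ge0 ?expR_ge0.
- apply: (measurable_fun_fubini_tonelli_G _ mh') => z.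
  by rewrite lee_fin mulr_ge0 ?expR_ge0.
- by apply: (measurable_fun_fubini_tonelli_G _ mg') => z; rewrite lee_fin.
move=> x _.
have mgx : measurable_fun [set: sub] (fun w : sub => g (w, x)).
  by apply: measurable_funM => //; exact: measurable_gauss_pdf.
have /= := subgaussian_weighted x me sg (fun w => g_ge0 (w, x)) mgx.
rewrite expr1n mulr1 => le_x.
have -> : (\int[P]_w (h (w, x))%:E =
    (expR (- (x ^+ 2 / 2)))%:E * \int[P]_w (g (w, x) * expR (x * e w))%:E)%E.
  rewrite -ge0_integralZl_EFin ?expR_ge0//.
  - apply: eq_integral => w _; rewrite /h /= expRD -EFinM; congr EFin; ring.
  - by move=> w _; rewrite lee_fin mulr_ge0 ?expR_ge0.
  - apply/measurable_EFinP; apply: measurable_funM.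
      exact: (measurable_fun_sub mgx).
    by apply: measurableT_comp => //; exact: measurable_funM.
apply: le_trans (lee_wpmul2l _ le_x) _; first by rewrite lee_fin expR_ge0.
(* The compensator exp(-x^2 / 2) cancels the sub-Gaussian factor exactly. *)
by rewrite muleA -EFinM -expRD addNr expR0 mul1e.
Qed.

(** Replace [lambda] by [lambda / Rsub]. *)
Lemma subgaussian_scale (e : Omega -> R) (Rsub : R) : 0 < Rsub ->
  subgaussian_given P <<s gens >> e Rsub ->
  subgaussian_given P <<s gens >> (fun w => e w / Rsub) 1.
Proof.
move=> Rsub_gt0 sg lambda A GA.
have := sg (lambda / Rsub) A GA.
rewrite expr1n mulr1 exprMn exprVn divfK ?expf_neq0 ?gt_eqF//.
apply: le_trans; rewrite le_eqVlt; apply/orP; left; apply/eqP.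
by apply: eq_integral => w _; congr (expR _)%:E; ring.
Qed.

End SubGaussian.

(** * Measurability of the posterior, over an arbitrary source so that it applies both to the full
    sigma-algebra and to the history *)

Section GaussianProcessMeasurability.
Context {R : realType} dX (X : measurableType dX) (kappa : X -> X -> R).
Hypothesis kappa_meas : measurable_fun setT (fun z : X * X => kappa z.1 z.2).
Variables (H : rkhs kappa) (zeta : R) (zeta_gt0 : 0 < zeta).
Context d (T : measurableType d).
Variables (x : nat -> T -> X) (e : nat -> T -> R) (t : nat).
Local Notation A w := (gram kappa (fun i : 'I_t => x i w) + zeta%:M).
Hypothesis mx : forall i, (i < t)%N -> measurable_fun setT (x i).

Lemma measurable_kernel (y z : T -> X) :
  measurable_fun setT y -> measurable_fun setT z ->
  measurable_fun setT (fun w => kappa (y w) (z w)).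
Proof.
move=> my mz; exact: measurableT_comp kappa_meas (measurable_fun_pair my mz).
Qed.

Lemma measurable_regularized i j : measurable_fun setT (fun w => A w i j).
Proof.
under eq_fun do rewrite !mxE.
by apply: measurable_funD => //; apply: measurable_kernel; exact: mx.
Qed.

Lemma measurable_regularized_det : measurable_fun setT (fun w => \det (A w)).
Proof. by apply: measurable_fun_det; exact: measurable_regularized. Qed.

Lemma regularized_det_gt0 w : 0 < \det (A w).
Proof.
rewrite (regularized_detE H zeta_gt0 (fun i => x i w)) prodr_gt0// => i _.
exact: (pred_var_gt0 H).
Qed.

Lemma measurable_regularized_inv i j :
  measurable_fun setT (fun w => invmx (A w) i j).
Proof.
(* Adjugate formula: each entry is a cofactor over a positive determinant. *)
have -> : (fun w => invmx (A w) i j) =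
    (fun w => (\det (A w))^-1 * ((-1) ^+ (j + i) * \det (row' j (col' i (A w))))).
  apply/funext => w; rewrite /invmx (regularized_unit H zeta_gt0).
  by rewrite [LHS]mxE [in LHS]mxE.
apply: measurable_funM.
  by apply: measurable_fun_inv_gt0; [exact: regularized_det_gt0|exact: measurable_regularized_det].
apply: measurable_funM => //; apply: measurable_fun_det => k l.
under eq_fun do rewrite !mxE.
by apply: measurable_funD => //; apply: measurable_kernel; exact: mx.
Qed.

Hypothesis me : forall i, (i < t)%N -> measurable_fun setT (e i).

Lemma measurable_noise_energy :
  measurable_fun setT
    (fun w => noise_energy kappa zeta (fun i : 'I_t => x i w) (fun i => e i w)).
Proof.
apply: measurable_funB.
  by apply: measurable_sum => i; apply: measurable_funX; exact: me.
apply: measurable_sum => i; apply: measurable_funM; first exact: me.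
under eq_fun do rewrite mxE.
apply: measurable_sum => j; apply: measurable_funM.
  exact: measurable_regularized_inv.
under eq_fun do rewrite mxE.
exact: me.
Qed.

Hypothesis mxt : measurable_fun setT (x t).

Lemma measurable_weights i :
  measurable_fun setT
    (fun w => weights kappa zeta (fun i : 'I_t => x i w) (x t w) i 0).
Proof.
under eq_fun do rewrite mxE.
apply: measurable_sum => j; apply: measurable_funM.
  exact: measurable_regularized_inv.
under eq_fun do rewrite mxE.
by apply: measurable_kernel => //; exact: mx.
Qed.

Lemma measurable_post_mean :
  measurable_fun setT
    (fun w => post_mean kappa zeta (fun i : 'I_t => x i w) (fun i => e i w) (x t w)).
Proof.
under eq_fun do rewrite (post_meanE H).
apply: measurable_sum => i; apply: measurable_funM; first exact: measurable_weights.
exact: me.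
Qed.

Lemma measurable_post_var :
  measurable_fun setT
    (fun w => post_var kappa zeta (fun i : 'I_t => x i w) (x t w)).
Proof.
rewrite /post_var; under eq_fun do rewrite (kvec_invE H).
apply: measurable_funB; first exact: measurable_kernel.
apply: measurable_sum => i; apply: measurable_funM; first exact: measurable_weights.
under eq_fun do rewrite mxE.
by apply: measurable_kernel => //; exact: mx.
Qed.

End GaussianProcessMeasurability.

Lemma measurable_forall_lt d (T : measurableType d) n (Q : nat -> T -> bool) :
  (forall t, (t < n)%N -> measurable_fun setT (Q t)) ->
  measurable [set w | forall t, (t < n)%N -> Q t w].
Proof.
move=> mQ.
have -> : [set w | forall t, (t < n)%N -> Q t w] =
    \bigcap_t [set w | (t < n)%N -> Q t w].
  by apply/seteqP; split=> [w h t _ tn|w h t tn]; [exact: h|exact: h t I tn].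
apply: bigcapT_measurable => t; have [tn|tn] := boolP (t < n)%N; last first.
  rewrite (_ : [set _ | _] = setT)//.
  by apply/seteqP; split.
rewrite (_ : [set _ | _] = setT `&` Q t @^-1` [set true]); last first.
  by apply/seteqP; split=> [w /= h|w /= [_ ->]//]; split=> //; exact: h.
exact: mQ.
Qed.

(** * Ville's maximal inequality over a finite horizon *)

Section Ville.
Context d (Omega : measurableType d) (R : realType) (P : probability Omega R).
Variables (M : nat -> Omega -> R) (a : R) (T : nat).

(** The inequality on [s] is strict, so [below t.+1] is determined by M up to time t and can weight
    the step from t to t + 1. *)
Definition below t : set Omega := [set w | forall s, (s < t)%N -> M s w <= a].

Hypotheses (a_gt0 : 0 < a) (M_ge0 : forall t w, 0 <= M t w).
Hypothesis mM : forall t, (t <= T)%N -> measurable_fun setT (M t).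
Hypothesis M0 : forall w, M 0 w = 1.
Hypothesis M_super : forall t, (t < T)%N ->
  (\int[P]_w (\1_(below t.+1) w * M t.+1 w)%:E <=
   \int[P]_w (\1_(below t.+1) w * M t w)%:E)%E.

Lemma measurable_below t : (t <= T)%N -> measurable (below t).
Proof.
move=> tT; apply: measurable_forall_lt => s st.
by apply: measurable_fun_ler => //; apply: mM; rewrite (leq_trans (ltnW st)).
Qed.

(* The process stopped at its first passage above [a] is a supermartingale. *)
Lemma ville : (a%:E * P (~` below T) <= 1)%E.
Proof.
(* After passage the process is frozen at [a] itself, not at the overshooting value of M. *)
pose S t w := a * \1_(~` below t) w + \1_(below t) w * M t w.
have mS t : (t <= T)%N -> measurable_fun setT (S t).
  move=> tT; have mb := measurable_below tT.
  apply: measurable_funD; last first.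
    by apply: measurable_funM; [exact: measurable_indic|exact: mM].
  apply: measurable_funM => //; apply: measurable_indic; exact: measurableC.
have a_ge0 := ltW a_gt0.
have S_ge0 t w : 0 <= S t w by rewrite addr_ge0 ?mulr_ge0.
have intS t : (t <= T)%N -> (\int[P]_w (S t w)%:E <= 1)%E.
  elim: t => [_|t IH tT].
    have -> : (\int[P]_w (S 0 w)%:E = \int[P]_w (cst 1 w))%E.
      apply: eq_integral => w _; rewrite /S !indicE M0.
      have -> : below 0 = setT by apply/seteqP; split.
      by rewrite setCT memNset// mem_set// mulr0 mul1r add0r.
    by rewrite integral_cst// mul1e; exact: (probability_le1 P measurableT).
  apply: le_trans (IH (ltnW tT)).
  have mb := measurable_below tT.
  have mC : measurable_fun setT (fun w => (a * \1_(~` below t.+1) w)%:E).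
    apply/measurable_EFinP; apply: measurable_funM => //.
    by apply: measurable_indic; exact: measurableC.
  have mI s : (s <= T)%N -> measurable_fun setT (fun w => (\1_(below t.+1) w * M s w)%:E).
    move=> sT; apply/measurable_EFinP; apply: measurable_funM; last exact: mM.
    exact: measurable_indic.
  have split_int s : (s <= T)%N ->
      (\int[P]_w (a * \1_(~` below t.+1) w + \1_(below t.+1) w * M s w)%:E =
       \int[P]_w (a * \1_(~` below t.+1) w)%:E +
       \int[P]_w (\1_(below t.+1) w * M s w)%:E)%E.
    move=> sT; rewrite -ge0_integralD//; last exact: mI.
    - by move=> w _; rewrite lee_fin mulr_ge0.
    - by move=> w _; rewrite lee_fin mulr_ge0.
  rewrite /S split_int//.
  apply: le_trans (leeD2l _ (M_super tT)) _.
  rewrite -split_int ?(ltnW tT)//.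
  apply: ge0_le_integral => //.
  - by move=> w _; rewrite lee_fin addr_ge0 ?mulr_ge0.
  - have := emeasurable_funD mC (mI t (ltnW tT)); by [].
  - by apply/measurable_EFinP; exact: (mS t (ltnW tT)).
  (* If passage occurs exactly at time t, then M t > a, so lowering the value to [a] decreases the
     process. *)
  - move=> w _; rewrite lee_fin !indicE !in_setC.
    have [|] := boolP (w \in below t.+1); rewrite !(inE, notin_setE) => h.
      have -> : w \in below t by rewrite inE => s st; exact: h (ltnW st).
      by rewrite /= mulr0.
    have [|_] := boolP (w \in below t); last by rewrite lexx.
    rewrite inE => h' /=.
    rewrite mulr1 mulr0 mul0r mul1r addr0 add0r leNgt; apply/negP => Ma.
    apply: h => s; rewrite ltnS leq_eqVlt => /orP[/eqP ->|]; [exact: ltW|exact: h'].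
have mb := measurable_below (leqnn T).
apply: le_trans (intS T (leqnn T)).
have -> : (a%:E * P (~` below T) = \int[P]_w (a * \1_(~` below T) w)%:E)%E.
  have mCb : measurable (~` below T) by exact: measurableC.
  under eq_integral do rewrite EFinM.
  rewrite ge0_integralZl_EFin//; last by apply/measurable_EFinP; exact: measurable_indic.
  by rewrite integral_indic// setIT.
apply: ge0_le_integral => //.
- by move=> w _; rewrite lee_fin mulr_ge0.
- apply/measurable_EFinP; apply: measurable_funM => //.
  by apply: measurable_indic; exact: measurableC.
- by apply/measurable_EFinP; exact: mS.
- by move=> w _; rewrite lee_fin lerDl mulr_ge0.
Qed.

End Ville.

(** * Scaling of the energy, determinants, and the sigma-algebra of the past *)

Lemma noise_energy_scale (R : realType) (X : Type) (kappa : X -> X -> R) (zeta : R)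
    t (a : 'I_t -> X) (e : 'I_t -> R) (c : R) :
  noise_energy kappa zeta a (fun i => e i * c) = noise_energy kappa zeta a e * c ^+ 2.
Proof.
rewrite /noise_energy mulrBl !mulr_suml; congr (_ - _).
  by apply: eq_bigr => i _; rewrite exprMn.
have -> : \col_j (e j * c) = c *: \col_j e j.
  by apply/colP => j; rewrite !mxE mulrC.
by apply: eq_bigr => i _; rewrite -scalemxAr [X in _ * X = _]mxE; ring.
Qed.

(** Every predictive variance in the product is at least zeta. *)
Lemma regularized_det_ge1 (R : realType) (X : Type) (kappa : X -> X -> R)
    (H : rkhs kappa) (zeta : R) (a : nat -> X) t : 1 <= zeta ->
  1 <= \det (gram kappa (fun i : 'I_t => a i) + zeta%:M).
Proof.
move=> zeta_ge1; have zeta_gt0 : 0 < zeta by apply: lt_le_trans zeta_ge1.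
rewrite (regularized_detE H zeta_gt0).
elim: t => [|t IH]; first by rewrite big_ord0.
rewrite big_ord_recr /= mulr_ege1// /pred_var.
by rewrite (le_trans zeta_ge1)// lerDl (post_var_ge0 H).
Qed.

Section History.
Context d (Omega : measurableType d) dX (X : measurableType dX) (R : realType).
Variables (x : nat -> Omega -> X) (eps : nat -> Omega -> R) (s : nat).

(** The generators of [history], named so that the generated sigma-algebra can serve as a measurable
    type. *)
Definition history_gens : set (set Omega) :=
  (\bigcup_(i in [set i | (i <= s)%N])
     preimage_set_system setT (x i) measurable) `|`
  (\bigcup_(i in [set i | (i < s)%N])
     preimage_set_system setT (eps i) measurable).

Local Notation sub := (g_sigma_algebraType history_gens).

Lemma history_measurable :
  (forall i, (i <= s)%N -> measurable_fun setT (x i)) ->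
  (forall i, (i < s)%N -> measurable_fun setT (eps i)) ->
  history x eps s `<=` @measurable _ Omega.
Proof.
move=> mx me; apply: smallest_sub; first exact: sigma_algebra_measurable.
by move=> A [] [i /= i_s [B mB <-]]; [exact: mx|exact: me].
Qed.

Lemma measurable_query i : (i <= s)%N -> measurable_fun [set: sub] (x i : sub -> X).
Proof. by move=> i_s _ B mB; apply: sub_sigma_algebra; left; exists i => //; exists B. Qed.

Lemma measurable_noise i : (i < s)%N -> measurable_fun [set: sub] (eps i : sub -> R).
Proof. by move=> i_s _ B mB; apply: sub_sigma_algebra; right; exists i => //; exists B. Qed.

End History.

(** * The confidence event and its probability *)

Section Confidence.
Context {R : realType} dX (X : measurableType dX) (kappa : X -> X -> R).
Hypothesis kappa_meas : measurable_fun setT (fun z : X * X => kappa z.1 z.2).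
Variables (H : rkhs kappa) (zeta : R) (zeta_gt1 : 1 < zeta).
Context d (Omega : measurableType d) (P : probability Omega R).
Variables (x : nat -> Omega -> X) (eps : nat -> Omega -> R) (T : nat).
Hypothesis mx : forall s, (s < T)%N -> measurable_fun setT (x s).
Hypothesis me : forall s, (s < T)%N -> measurable_fun setT (eps s).

Local Notation energy t w :=
  (noise_energy kappa zeta (fun i : 'I_t => x i w) (fun i => eps i w)).
Local Notation detA t w := (\det (gram kappa (fun i : 'I_t => x i w) + zeta%:M)).

Let zeta_gt0 : 0 < zeta. Proof. exact: lt_trans zeta_gt1. Qed.

(** The times t < T suffice because the query of iteration t uses only the t earlier
    observations. *)
Definition confident (Rsub delta : R) : set Omega :=
  [set w | forall t, (t < T)%N ->
     energy t w <= Rsub ^+ 2 * (ln (detA t w) + 2 * ln (1 / delta))].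

Lemma measurable_confident Rsub delta : measurable (confident Rsub delta).
Proof.
apply: measurable_forall_lt => t tT.
have mx' i : (i < t)%N -> measurable_fun setT (x i).
  by move=> it; apply: mx; exact: ltn_trans tT.
have me' i : (i < t)%N -> measurable_fun setT (eps i).
  by move=> it; apply: me; exact: ltn_trans tT.
apply: measurable_fun_ler; first exact: (measurable_noise_energy kappa_meas H).
apply: measurable_funM => //; apply: measurable_funD => //.
apply: measurableT_comp (@measurable_ln R) _.
exact: (measurable_regularized_det kappa_meas).
Qed.

(* Likelihood ratio of the Gaussian model with covariance K + zeta I against
   i.i.d. standard noise, evaluated at eps / Rsub. *)
Let M (Rsub : R) t w : R := expR ((energy t w / Rsub ^+ 2 - ln (detA t w)) / 2).

(** The energy and determinant recursions combine into the factor produced by tilting a Gaussian of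
    mean [m] and variance [v]. *)
Lemma likelihood_ratioS (Rsub : R) t w : 0 < Rsub ->
  let e := eps t w / Rsub in
  let m := post_mean kappa zeta (fun i : 'I_t => x i w)
             (fun i => eps i w / Rsub) (x t w) in
  let v := pred_var kappa zeta (fun i => x i w) t - 1 in
  M Rsub t.+1 w =
  M Rsub t w * expR ((e ^+ 2 - (e - m) ^+ 2 / (1 + v) - ln (1 + v)) / 2).
Proof.
move=> Rsub_gt0 e m v.
have vE : 1 + v = pred_var kappa zeta (fun i => x i w) t by rewrite /v addrC subrK.
have s_gt0 : 0 < pred_var kappa zeta (fun i => x i w) t by exact: (pred_var_gt0 H).
rewrite vE /M -expRD; congr expR.
rewrite (regularized_detS H zeta_gt0 (fun i => x i w)) lnM ?posrE//; last first.
  exact: (regularized_det_gt0 H zeta_gt0).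
have energy_scale n : energy n w / Rsub ^+ 2 =
    noise_energy kappa zeta (fun i : 'I_n => x i w) (fun i => eps i w / Rsub).
  by rewrite noise_energy_scale exprVn.
rewrite !energy_scale (noise_energyS H zeta_gt0 (fun i => x i w) t (fun i => eps i w / Rsub)).
rewrite -/e -/m; ring.
Qed.

(** Ville's inequality at level 1 / delta; taking logarithms of M <= 1 / delta gives the energy
    bound. *)
Lemma confidence_gt0 (Rsub delta : R) : 0 < Rsub -> 0 < delta ->
  (forall s, (s < T)%N -> subgaussian_given P (history x eps s) (eps s) Rsub) ->
  ((1 - delta)%:E <= P (confident Rsub delta))%E.
Proof.
move=> Rsub_gt0 delta_gt0 sg.
have idelta_gt0 : 0 < 1 / delta by rewrite divr_gt0.
(* Stated through a map [f], to be used with the identity for both sigma-algebras on [Omega]. *)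
have mM d' (T' : measurableType d') (f : T' -> Omega) t : 
    (forall i, (i < t)%N -> measurable_fun setT (x i \o f)) ->
    (forall i, (i < t)%N -> measurable_fun setT (eps i \o f)) ->
    measurable_fun setT (M Rsub t \o f).
  move=> mxf mef.
  have -> : M Rsub t \o f =
      expR \o (fun w => (energy t (f w) / Rsub ^+ 2 - ln (detA t (f w))) / 2) by [].
  apply: measurableT_comp => //; apply: measurable_funM => //.
  apply: measurable_funB.
    apply: measurable_funM => //.
    exact: (measurable_noise_energy kappa_meas H zeta_gt0 mxf mef).
  apply: measurableT_comp (@measurable_ln R) _.
  exact: (measurable_regularized_det kappa_meas zeta mxf).
have mM' t : (t <= T)%N -> measurable_fun setT (M Rsub t).
  move=> tT; apply: (mM _ _ id) => i it.
    by apply: mx; exact: leq_trans tT.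
  by apply: me; exact: leq_trans tT.
have M0 w : M Rsub 0 w = 1.
  by rewrite /M /noise_energy !big_ord0 det_mx00 ln1 !(subr0, mul0r) expR0.
have belowE : below (M Rsub) (1 / delta) T = confident Rsub delta.
  have key t w : (M Rsub t w <= 1 / delta) =
      (energy t w <= Rsub ^+ 2 * (ln (detA t w) + 2 * ln (1 / delta))).
    rewrite /M -[in LHS](lnK (x := 1 / delta)) ?posrE// ler_expR ler_pdivrMr// lerBlDr.
    by rewrite ler_pdivrMr ?exprn_gt0// mulrC [_ * 2]mulrC [_ + ln (detA _ _)]addrC.
  by apply/seteqP; split=> w h t /h; rewrite key.
have M_super t : (t < T)%N ->
  (\int[P]_w (\1_(below (M Rsub) (1 / delta) t.+1) w * M Rsub t.+1 w)%:E <=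
   \int[P]_w (\1_(below (M Rsub) (1 / delta) t.+1) w * M Rsub t w)%:E)%E.
  move=> tT.
  have gens_meas : <<s history_gens x eps t >> `<=` @measurable _ Omega.
    apply: history_measurable => i it; [apply: mx|apply: me].
      exact: leq_ltn_trans tT.
    exact: ltn_trans tT.
  have mxs i : (i <= t)%N ->
      measurable_fun [set: g_sigma_algebraType (history_gens x eps t)] (x i).
    exact: measurable_query.
  have mes i : (i < t)%N ->
      measurable_fun [set: g_sigma_algebraType (history_gens x eps t)] (eps i).
    exact: measurable_noise.
  have mMs s : (s <= t)%N ->
      measurable_fun [set: g_sigma_algebraType (history_gens x eps t)] (M Rsub s).
    move=> st; apply: (@mM _ (g_sigma_algebraType (history_gens x eps t)) id s) => i it;
      [apply: mxs|apply: mes].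
      exact: leq_trans (ltnW it) st.
    exact: leq_trans it st.
  have mess i : (i < t)%N ->
      measurable_fun [set: g_sigma_algebraType (history_gens x eps t)]
        (fun w => eps i w / Rsub).
    by move=> it; apply: measurable_funM => //; exact: mes.
  under eq_integral do rewrite (likelihood_ratioS t _ Rsub_gt0) mulrA.
  (* The weight Z is the indicator of no passage times M t; Z, the mean and the variance depend only
     on the queries up to t and the errors before t. *)
  apply: (subgaussian_mixture gens_meas).
  - by apply: measurable_funM => //; exact: me.
  - exact: (subgaussian_scale Rsub_gt0 (sg t tT)).
  - by move=> w; rewrite mulr_ge0 ?expR_ge0.
  (* The mixing variance is positive because zeta > 1 strictly. *)
  - move=> w; rewrite subr_gt0 (lt_le_trans zeta_gt1)// lerDl.
    by rewrite (post_var_ge0 H).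
  - apply: measurable_funM; last exact: mMs.
    apply: measurable_indic; apply: measurable_forall_lt => s st.
    by apply: measurable_fun_ler => //; exact: mMs.
  - by apply: (measurable_post_mean kappa_meas H zeta_gt0 _ mess) => [i it|];
      apply: mxs => //; exact: ltnW.
  - apply: measurable_funB => //; apply: measurable_funD => //.
    by apply: (measurable_post_var kappa_meas H zeta_gt0) => [i it|];
      apply: mxs => //; exact: ltnW.
have := ville idelta_gt0 (fun t w => expR_ge0 _) mM' M0 M_super.
rewrite belowE probability_setC; last exact: measurable_confident.
have : P (confident Rsub delta) \is a fin_num.
  by apply: fin_num_measure; exact: measurable_confident.
case: (P _) => // r _; rewrite -EFinB -EFinM !lee_fin mul1r mulrC ler_pdivrMr//.
by rewrite mul1r lerBlDr addrC -lerBlDr.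
Qed.

Lemma subgaussian_weaken (G : set (set Omega)) (e : Omega -> R) (r r' : R) :
  0 <= r <= r' -> subgaussian_given P G e r -> subgaussian_given P G e r'.
Proof.
move=> /andP[r_ge0 rr'] sg lambda A GA; apply: le_trans (sg lambda A GA) _.
apply: lee_wpmul2r => //; rewrite lee_fin ler_expR ler_pM2r// ler_wpM2l ?sqr_ge0//.
by rewrite ler_sqr// nnegrE// (le_trans r_ge0).
Qed.

(* [Rsub = 0] is the limit of [Rsub = 1 / (n + 1)]. *)
Lemma confidence (Rsub delta : R) : 0 <= Rsub -> 0 < delta < 1 ->
  (forall s, (s < T)%N -> subgaussian_given P (history x eps s) (eps s) Rsub) ->
  ((1 - delta)%:E <= P (confident Rsub delta))%E.
Proof.
move=> Rsub_ge0 /andP[delta_gt0 delta_lt1] sg.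
have [Rsub0|Rsub_neq0] := eqVneq Rsub 0; last first.
  by apply: confidence_gt0 => //; rewrite lt_neqAle eq_sym Rsub_neq0.
have sg0 n s : (s < T)%N -> subgaussian_given P (history x eps s) (eps s) (n.+1%:R^-1).
  move=> sT; apply: subgaussian_weaken (sg s sT).
  by rewrite Rsub0 lexx /= invr_ge0 ler0n.
rewrite Rsub0.
pose F n := confident n.+1%:R^-1 delta.
have mF n : measurable (F n) by exact: measurable_confident.
have mcap : measurable (\bigcap_n F n) by exact: bigcapT_measurable.
have y_ge0 t w : 0 <= ln (detA t w) + 2 * ln (1 / delta).
  apply: addr_ge0; first by apply/ln_ge0/(regularized_det_ge1 H (fun i => x i w))/ltW.
  by rewrite mulr_ge0// ln_ge0// mul1r invf_ge1// ltW.
have cap_sub : \bigcap_n F n `<=` confident 0 delta.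
  move=> w Fw t tT; rewrite expr0n mul0r leNgt; apply/negP => E_gt0.
  (* Write y for the log bound: some n exceeds y / energy, so y / (n + 1)^2 <= y / (n + 1) < energy,
     against membership in [F n]. *)
  have := archi_boundP (divr_ge0 (y_ge0 t w) (ltW E_gt0)).
  set n := Num.bound _; rewrite ltr_pdivrMr// => yn.
  have := Fw n I t tT; apply/negP; rewrite -ltNge.
  have n_gt0 : 0 < n.+1%:R :> R by rewrite ltr0n.
  apply: (@le_lt_trans _ _ ((ln (detA t w) + 2 * ln (1 / delta)) / n.+1%:R)).
    rewrite mulrC ler_wpM2l// expr2 ler_piMl ?invr_ge0 ?ler0n//.
    by rewrite invf_le1// ler1n.
  rewrite ltr_pdivrMr// (lt_le_trans yn)// mulrC ler_pM2l// ler_nat.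
  exact: leqnSn.
have F_noninc : nonincreasing_seq F.
  move=> n n' nn'; apply/subsetPset => w Fw t tT; apply: le_trans (Fw t tT) _.
  rewrite ler_wpM2r ?y_ge0// ler_sqr ?nnegrE ?invr_ge0//.
  by rewrite lef_pV2 ?posrE// ler_nat.
have F_cvg := nonincreasing_cvg_mu (le_lt_trans (probability_le1 P (mF 0)) (ltry 1)) mF mcap F_noninc.
apply: (@le_trans _ _ (P (\bigcap_n F n))).
  rewrite -(cvg_lim _ F_cvg)//; apply: lime_ge; first by apply/cvg_ex; eexists; exact: F_cvg.
  apply: nearW => n; apply: confidence_gt0 => // s; exact: sg0.
by rewrite le_measure ?inE//; exact: measurable_confident.
Qed.

End Confidence.

(** * Information gain: monotonicity and the kernel bound *)

Section InformationGain.
Context {R : realType} {X : Type} (kappa : X -> X -> R) (H : rkhs kappa).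

Lemma ln_regularized_det (zeta : R) (a : nat -> X) t : 0 < zeta ->
  ln (\det (gram kappa (fun i : 'I_t => a i) + zeta%:M)) =
  2 * info_gain kappa zeta (fun i : 'I_t => a i) + t%:R * ln zeta.
Proof.
move=> zeta_gt0; rewrite /info_gain mulrA divff ?pnatr_eq0// mul1r.
have -> : 1%:M + zeta^-1 *: gram kappa (fun i : 'I_t => a i) =
    zeta^-1 *: (gram kappa (fun i : 'I_t => a i) + zeta%:M).
  by rewrite scalerDr scale_scalar_mx mulVf ?gt_eqF// addrC.
have det_gt0 : 0 < \det (gram kappa (fun i : 'I_t => a i) + zeta%:M).
  rewrite (regularized_detE H zeta_gt0) prodr_gt0// => i _.
  exact: (pred_var_gt0 H).
rewrite detZ lnM ?posrE ?exprn_gt0 ?invr_gt0// lnXn ?invr_gt0//.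
by rewrite lnV ?posrE// -[_ *+ t]mulr_natl; ring.
Qed.

(** This is ln y <= y - 1 at y = 1 / (1 + z). *)
Lemma ln1D_ge (z : R) : 0 <= z -> z <= (1 + z) * ln (1 + z).
Proof.
move=> z_ge0; have z1_gt0 : 0 < 1 + z by rewrite ltr_pwDl.
have := @le_ln1Dx R ((1 + z)^-1 - 1).
rewrite [1 + (_ - 1)]addrC subrK lnV ?posrE// => h.
have {h} : - ln (1 + z) <= (1 + z)^-1 - 1.
  by apply: h; rewrite ltrBrDr addNr invr_gt0.
rewrite -(ler_pM2l z1_gt0) mulrBr divff ?gt_eqF// mulr1; lra.
Qed.

Lemma info_gain_mono (zeta : R) (a : nat -> X) (s t : nat) :
  0 < zeta -> (s <= t)%N ->
  info_gain kappa zeta (fun i : 'I_s => a i) <=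
  info_gain kappa zeta (fun i : 'I_t => a i).
Proof.
move=> zeta_gt0 /subnK <-; elim: (t - s)%N => [|n IH]; first by rewrite add0n.
apply: le_trans IH _; rewrite addSn !(info_gainE H zeta_gt0) ler_pM2l ?invr_gt0//.
rewrite big_ord_recr /= lerDl ln_ge0// lerDl.
by rewrite divr_ge0 ?(post_var_ge0 H)// ltW.
Qed.

Lemma info_gain_le (zeta : R) t (a : 'I_t -> X) :
  max_info_gain_finite kappa zeta t ->
  info_gain kappa zeta a <= max_info_gain kappa zeta t.
Proof. by move=> fin; apply: sup_upper_bound => //; split=> //; exists (info_gain kappa zeta a); exists a. Qed.

(** A collection of s points is padded with [x0]; extra points only add nonnegative terms to the
    gain. *)
Lemma max_info_gain_mono (zeta : R) (x0 : X) (s t : nat) :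
  0 < zeta -> (s <= t)%N -> max_info_gain_finite kappa zeta t ->
  max_info_gain kappa zeta s <= max_info_gain kappa zeta t.
Proof.
move=> zeta_gt0 st fin; apply: ge_sup.
  by exists (info_gain kappa zeta (fun _ : 'I_s => x0)); exists (fun=> x0).
move=> _ [a _ <-].
pose b i := oapp a x0 (insub i).
have -> : a = (fun i : 'I_s => b i).
  by apply/funext => i; rewrite /b valK.
apply: le_trans (info_gain_mono _ zeta_gt0 st) _; exact: info_gain_le.
Qed.

(** For T = t = 1 one has zeta = 3, and the gain of a single point is ln (1 + kappa x x / 3) / 2; a
    bound u on it bounds the diagonal. *)
Lemma kernel_bound : (forall T t : nat, (0 < T)%N -> (t <= T)%N ->
    max_info_gain_finite kappa (gp_zeta R T) t) ->
  exists2 K : R, 0 < K & forall x, kappa x x <= K.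
Proof.
move=> /(_ 1 1 isT isT)[u ub]; exists (3 * expR (2 * u)); first by rewrite mulr_gt0 ?expR_gt0.
move=> x; have [k_le0|k_gt0] := leP (kappa x x) 0.
  by rewrite (le_trans k_le0)// mulr_ge0 ?expR_ge0.
have zeta3 : gp_zeta R 1 = 3 by rewrite /gp_zeta divr1; ring.
have := ub (info_gain kappa (gp_zeta R 1) (fun _ : 'I_1 => x)) (ex_intro2 _ _ _ I erefl).
rewrite /info_gain det_mx11 !mxE /= mulr1n zeta3.
have k1_gt0 : 0 < 1 + 3^-1 * kappa x x by rewrite addr_gt0// mulr_gt0.
rewrite mulrC ler_pdivrMr// => h; rewrite -ler_expR lnK ?posrE// in h.
have -> : 2 * u = u * 2 by rewrite mulrC.
move: (expR_gt0 (u * 2)) h; lra.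
Qed.

End InformationGain.

(** * Deterministic regret analysis on the confidence event *)

Section Regret.
Context {R : realType} {X : Type} (kappa : X -> X -> R) (H : rkhs kappa).
Variables (T : nat) (T_gt0 : (0 < T)%N) (K : R) (K_ge0 : 0 <= K).
Hypothesis kappa_le : forall x, kappa x x <= K.
Local Notation zeta := (gp_zeta R T).
Local Notation gamma t := (max_info_gain kappa zeta t).
Hypothesis gamma_fin : forall t, (t <= T)%N -> max_info_gain_finite kappa zeta t.
Variables (f : H) (Bnorm Rsub delta : R).
Hypotheses (fB : Num.sqrt (rkhs_dot H f f) <= Bnorm) (Rsub_ge0 : 0 <= Rsub).
Hypothesis delta01 : 0 < delta < 1.
Variables (a : nat -> X) (e : nat -> R) (xstar : X).
Local Notation sigma2 t x := (post_var kappa zeta (fun i : 'I_t => a i) x).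
Local Notation beta := (igp_ucb_beta Bnorm Rsub delta).
Hypothesis conf : forall t, (t < T)%N ->
  noise_energy kappa zeta (fun i : 'I_t => a i) (fun i => e i) <=
  Rsub ^+ 2 * (ln (\det (gram kappa (fun i : 'I_t => a i) + zeta%:M))
               + 2 * ln (1 / delta)).
Hypothesis ucb_max : forall t, (t < T)%N ->
  is_argmax (fun x => post_mean kappa zeta (fun i : 'I_t => a i)
                        (fun i => rkhs_fun f (a i) + e i) x
                      + beta (gamma t) * Num.sqrt (sigma2 t x)) (a t).

Let T_gt0R : 0 < T%:R :> R. Proof. by rewrite ltr0n. Qed.

Let zeta_gt1 : 1 < zeta.
Proof. by rewrite ltrDl divr_gt0. Qed.

Let zeta_gt0 : 0 < zeta. Proof. exact: lt_trans zeta_gt1. Qed.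

Let zeta_le3 : zeta <= 3.
Proof.
have : 2 / T%:R <= (2 : R) by rewrite ler_pdivrMr// ler_peMr// ler1n.
rewrite /gp_zeta; lra.
Qed.

Let Bnorm_ge0 : 0 <= Bnorm.
Proof. exact: le_trans (sqrtr_ge0 _) fB. Qed.

Lemma lnV_delta_ge0 : 0 <= ln (1 / delta).
Proof.
case/andP: delta01 => d_gt0 d_lt1.
by rewrite ln_ge0// mul1r invf_ge1// ltW.
Qed.

Lemma gamma_mono t : (t <= T)%N -> gamma t <= gamma T.
Proof. by move=> tT; apply: (max_info_gain_mono H) => //; exact: gamma_fin. Qed.

Lemma confidence_width t x : (t < T)%N ->
  `|post_mean kappa zeta (fun i : 'I_t => a i) (fun i => rkhs_fun f (a i) + e i) x
    - rkhs_fun f x| <= beta (gamma t) * Num.sqrt (sigma2 t x).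
Proof.
move=> tT; apply: le_trans (post_mean_error zeta_gt0 _ (ltW zeta_gt1) _ _ fB) _.
rewrite ler_wpM2r ?sqrtr_ge0// lerD2l.
have g_ub := info_gain_le (fun i : 'I_t => a i) (gamma_fin (ltnW tT)).
(* Since zeta = 1 + 2 / T and t < T; halved, this is the summand 1 in beta. *)
have ln_zeta : t%:R * ln zeta <= 2.
  have h : ln zeta <= 2 / T%:R.
    by apply: le_ln1Dx; rewrite (lt_trans (ltrN10 _))// divr_gt0.
  apply: le_trans (ler_wpM2l (ler0n R t) h) _.
  by rewrite mulrCA ler_piMr// ler_pdivrMr// mul1r ler_nat ltnW.
have Rsub2_ge0 := sqr_ge0 Rsub.
have h := conf tT; rewrite (ln_regularized_det H _ _ zeta_gt0) in h.
apply: le_trans (ler_wsqrtr (le_trans h (ler_wpM2l Rsub2_ge0 _))) _.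
  by instantiate (1 := 2 * (gamma t + 1 + ln (1 / delta))); lra.
by rewrite sqrtrM// sqrtr_sqr ger0_norm.
Qed.

Lemma beta_mono t : (t <= T)%N -> beta (gamma t) <= beta (gamma T).
Proof.
move=> tT; rewrite lerD2l ler_wpM2l// ler_wsqrtr// ler_pM2l// !lerD2r.
exact: gamma_mono.
Qed.

(** The upper confidence bound at [xstar] is at most that at [a t], which exceeds the true value by
    at most two widths. *)
Lemma instant_regret t : (t < T)%N ->
  rkhs_fun f xstar - rkhs_fun f (a t) <=
  2 * beta (gamma T) * Num.sqrt (sigma2 t (a t)).
Proof.
move=> tT.
have := confidence_width xstar tT; rewrite ler_norml => /andP[h1 _].
have := confidence_width (a t) tT; rewrite ler_norml => /andP[_ h2].
have h3 := ucb_max tT xstar.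
have := ler_wpM2r (sqrtr_ge0 (sigma2 t (a t))) (beta_mono (ltnW tT)).
move: h1 h2 h3 => /=; lra.
Qed.

(** With z = sigma^2 / zeta <= K one has z <= (1 + K) ln (1 + z). The factor 6 is the bound 3 on
    zeta times the 2 that undoes the half in the information gain. *)
Lemma sum_post_var :
  \sum_(t < T) sigma2 t (a t) <= 6 * (1 + K) * gamma T.
Proof.
have g_ub := info_gain_le (fun i : 'I_T => a i) (gamma_fin (leqnn T)).
apply: (@le_trans _ _ (6 * (1 + K) * info_gain kappa zeta (fun i : 'I_T => a i))); last first.
  by rewrite ler_wpM2l// mulr_ge0// addr_ge0.
rewrite (info_gainE H zeta_gt0) mulrA mulr_sumr; apply: ler_sum => t _.
set s2 := post_var _ _ _ _; set z := s2 / zeta.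
have s2_ge0 : 0 <= s2 by exact: (post_var_ge0 H).
have z_ge0 : 0 <= z by rewrite divr_ge0// ltW.
have z_le : z <= K.
  rewrite ler_pdivrMr// (le_trans (post_var_le H zeta_gt0 _ _))//.
  by rewrite (le_trans (kappa_le _))// ler_peMr// ltW.
have ln_ge0' : 0 <= ln (1 + z) by rewrite ln_ge0// lerDl.
have h : z <= (1 + K) * ln (1 + z).
  by apply: le_trans (ln1D_ge z_ge0) _; rewrite ler_wpM2r// lerD2l.
have -> : s2 = zeta * z by rewrite mulrC divfK// gt_eqF.
have -> : 6 * (1 + K) / 2 * ln (1 + z) = 3 * ((1 + K) * ln (1 + z)) by field.
by rewrite ler_pM// ltW.
Qed.

Lemma cumulative_regret :
  \sum_(t < T) (rkhs_fun f xstar - rkhs_fun f (a t)) <=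
  2 * beta (gamma T) * Num.sqrt (T%:R * (6 * (1 + K) * gamma T)).
Proof.
apply: (@le_trans _ _ (\sum_(t < T) 2 * beta (gamma T) * Num.sqrt (sigma2 t (a t)))).
  by apply: ler_sum => t _; exact: instant_regret.
rewrite -mulr_sumr ler_wpM2l//.
  by rewrite mulr_ge0// addr_ge0// mulr_ge0// sqrtr_ge0.
have sum_ge0 : 0 <= \sum_(t < T) Num.sqrt (sigma2 t (a t)).
  by apply: sumr_ge0 => t _; exact: sqrtr_ge0.
rewrite -[leLHS]ger0_norm// -sqrtr_sqr ler_wsqrtr//.
(* Cauchy-Schwarz against the all-ones vector yields the factor T. *)
have := sum_CauchySchwarz (const_mx 1 : 'cV[R]_T) (\col_t Num.sqrt (sigma2 t (a t))).
under eq_bigr do rewrite !mxE mul1r.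
under [X in _ <= X * _]eq_bigr do rewrite mxE expr1n.
under [X in _ <= _ * X]eq_bigr do rewrite mxE sqr_sqrtr ?(post_var_ge0 H)//.
rewrite sumr_const card_ord => /le_trans; apply.
by rewrite ler_wpM2l// sum_post_var.
Qed.

End Regret.

(** * From cumulative regret to a rate in the training budget *)

Lemma rate_bound (R : realType) (g0 gamma l Bnorm Rsub K rho : R) (T : nat) :
  0 < g0 <= gamma -> 0 <= l -> 0 <= Bnorm -> 0 <= Rsub -> 0 <= K -> (0 < T)%N ->
  T%:R^-1 <= rho ->
  T%:R^-1 * (2 * (Bnorm + Rsub * Num.sqrt (2 * (gamma + 1 + l))) *
             Num.sqrt (T%:R * (6 * (1 + K) * gamma))) <=
  2 * Num.sqrt (6 * (1 + K)) * Num.sqrt (2 * (1 + g0^-1)) *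
  (Num.sqrt rho * (Bnorm * Num.sqrt gamma + Rsub * Num.sqrt (gamma ^+ 2 + gamma * l))).
Proof.
move=> /andP[g0_gt0 g0_le] l_ge0 B_ge0 R_ge0 K_ge0 T_gt0 T_rho.
have T_gt0R : 0 < T%:R :> R by rewrite ltr0n.
have gamma_gt0 : 0 < gamma by exact: lt_le_trans g0_le.
have gamma_ge0 := ltW gamma_gt0.
set q := Num.sqrt (2 * (1 + g0^-1)).
have ig0_ge0 : 0 <= g0^-1 by rewrite invr_ge0 ltW.
have q_ge1 : 1 <= q by rewrite -[leLHS]sqrtr1 ler_wsqrtr//; lra.
have q_ge0 : 0 <= q by exact: sqrtr_ge0.
(* The lone 1 contributes gamma, which is at most gamma^2 / g0 because gamma >= g0. *)
have width : Num.sqrt (2 * (gamma + 1 + l)) * Num.sqrt gamma <=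
    q * Num.sqrt (gamma ^+ 2 + gamma * l).
  rewrite -!sqrtrM; [|lra|lra]; rewrite ler_wsqrtr//.
  have : gamma <= g0^-1 * gamma ^+ 2.
    by rewrite ler_pdivlMl// expr2 ler_wpM2r.
  have : 0 <= g0^-1 * (gamma * l) by rewrite !mulr_ge0.
  have : 0 <= gamma * l by rewrite mulr_ge0.
  rewrite expr2; lra.
have scale : T%:R^-1 * Num.sqrt (T%:R * (6 * (1 + K) * gamma)) =
    Num.sqrt T%:R^-1 * (Num.sqrt (6 * (1 + K)) * Num.sqrt gamma).
  rewrite -!sqrtrM ?mulr_ge0 ?addr_ge0 ?invr_ge0 ?ler0n//.
  rewrite -[X in X * _ = _](@ger0_norm _ T%:R^-1) ?invr_ge0 ?ler0n// -sqrtr_sqr.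
  rewrite -sqrtrM ?sqr_ge0//; congr Num.sqrt.
  by field; rewrite gt_eqF.
have -> : T%:R^-1 * (2 * (Bnorm + Rsub * Num.sqrt (2 * (gamma + 1 + l))) *
      Num.sqrt (T%:R * (6 * (1 + K) * gamma))) =
    2 * (Bnorm + Rsub * Num.sqrt (2 * (gamma + 1 + l))) *
    (T%:R^-1 * Num.sqrt (T%:R * (6 * (1 + K) * gamma))) by ring.
rewrite scale.
have -> : 2 * (Bnorm + Rsub * Num.sqrt (2 * (gamma + 1 + l))) *
    (Num.sqrt T%:R^-1 * (Num.sqrt (6 * (1 + K)) * Num.sqrt gamma)) =
    (2 * Num.sqrt (6 * (1 + K))) * (Num.sqrt T%:R^-1 *
      (Bnorm * Num.sqrt gamma +
       Rsub * (Num.sqrt (2 * (gamma + 1 + l)) * Num.sqrt gamma))) by ring.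
rewrite -!mulrA ler_wpM2l// ler_wpM2l ?sqrtr_ge0// [X in _ <= X]mulrCA.
rewrite ler_pM ?sqrtr_ge0//.
- by rewrite addr_ge0// !mulr_ge0// ?sqrtr_ge0// mulr_ge0 ?sqrtr_ge0.
- exact: ler_wsqrtr.
rewrite [q * _]mulrDr; apply: lerD.
  by rewrite ler_peMl// mulr_ge0 ?sqrtr_ge0.
by rewrite [leRHS]mulrCA ler_wpM2l.
Qed.

(** Affording T but not T + 1 iterations characterizes the integer quotient; the budget affords at
    least one iteration, so T > 0. *)
Lemma jobs_iterations (C N B Bsmall T : nat) : (0 < Bsmall)%N -> (N * B + Bsmall < C)%N ->
  jobs_exhausts C N B Bsmall T ->
  [/\ T = ((C - N * B) %/ Bsmall)%N, (0 < T)%N & (C < N * B + T.+1 * Bsmall)%N].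
Proof.
move=> Bs_gt0 C_gt; rewrite /jobs_exhausts /jobs_cost !sum_nat_const !card_ord => /andP[lo hi].
have T_gt0 : (0 < T)%N by case: T lo hi => // _; rewrite mul1n => hi; lia.
split=> //; apply/eqP; rewrite eqn_leq leq_divRL//; apply/andP; split; first by lia.
by rewrite -ltnS ltn_divLR//; lia.
Qed.

(** The floor loses less than one iteration: T Bsmall > C - N B - Bsmall, whence the extra Bsmall in
    the denominator. *)
Lemma inv_iterations_le (R : realType) (C N B Bsmall T : nat) :
  (0 < T)%N -> (N * B + Bsmall < C)%N -> (C < N * B + T.+1 * Bsmall)%N ->
  T%:R^-1 <= Bsmall%:R / (C%:R - N%:R * B%:R - Bsmall%:R) :> R.
Proof.
move=> T_gt0 C_gt C_lt.
have D_gt0 : 0 < C%:R - N%:R * B%:R - Bsmall%:R :> R.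
  by rewrite -addrA -opprD subr_gt0 -natrM -natrD ltr_nat.
rewrite -[leLHS]mul1r ler_pdivrMr ?ltr0n// mulrAC ler_pdivlMr// mul1r.
rewrite -addrA -opprD lerBlDr -!natrM -!natrD ler_nat.
by move: C_lt; rewrite mulSn (mulnC T); lia.
Qed.

(** The constant is fixed by [kappa] before the landscape, the budget and the probability space are
    given, so the O-bound is uniform in them. *)
Theorem theorem5p1 (R : realType) (m p : nat) (Mod : set 'rV[R]_p)
    (x0 : set_type (config_set (m := m) Mod))
    (kappa : config x0 -> config x0 -> R)
    (kappa_meas : measurable_fun setT
       (fun z : config x0 * config x0 => kappa z.1 z.2))
    (gamma_fin : forall T t : nat, (0 < T)%N -> (t <= T)%N ->
       max_info_gain_finite kappa (gp_zeta R T) t) :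
  exists2 c : R, 0 < c &
  forall (H : rkhs kappa) (L : config x0 -> R) (xstar : config x0)
    (Bnorm k delta : R) (N B Bsmall C T : nat)
    (d : measure_display) (Omega : measurableType d) (P : probability Omega R)
    (W : Type) (metric : W -> R)
    (theta : nat -> Omega -> config x0 -> nat -> W)
    (design : 'I_N -> Omega -> config x0)
    (learn : ('I_N -> config x0 * R * R) -> config x0 -> R -> R)
    (x : nat -> Omega -> config x0),
  let y := observation metric theta B Bsmall design learn x in
  let eps := prediction_error metric theta B Bsmall design learn x L in
  let Rsub := k / Num.sqrt N%:R in
  let zeta := gp_zeta R T in
  let gamma := max_info_gain kappa zeta T in
  let rate := Num.sqrt (Bsmall%:R / (C%:R - N%:R * B%:R - Bsmall%:R)) *
    (Bnorm * Num.sqrt gamma +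
     k / Num.sqrt N%:R * Num.sqrt (gamma ^+ 2 + gamma * ln (1 / delta))) in
  (0 < N)%N -> (0 < Bsmall)%N -> (Bsmall < B)%N -> (N * B + Bsmall < C)%N ->
  0 < delta < 1 -> 0 <= k ->
  (exists2 f : H, rkhs_fun f = L & Num.sqrt (rkhs_dot H f f) <= Bnorm) ->
  is_argmax L xstar ->
  (forall r w x', metric (theta r w x' B) = L x') ->
  (forall i, measurable_fun setT (design i)) ->
  jobs_exhausts C N B Bsmall T ->
  (forall s, (s < T)%N ->
     [/\ measurable_fun setT (x s),
         measurable_fun setT (y s),
         measurable_fun setT (eps s),
         subgaussian_given P (history x eps s) (eps s) Rsub &
         forall w, is_argmax (ucb metric theta B Bsmall design learn x
                                kappa zeta Bnorm Rsub delta s w) (x s w)]) ->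
  T = ((C - N * B) %/ Bsmall)%N /\
  ((1 - delta)%:E <=
   P [set w | (avg_regret x L xstar T w <= c * rate)%R])%E.
Proof.
have [K K_gt0 kappa_le] := kernel_bound gamma_fin.
pose has_pos := exists x, 0 < kappa x x.
(* [g0] is the gain of one point at the largest noise level, zeta = 3; 1 is a dummy value when the
   diagonal is nowhere positive. *)
have [g0 g0_gt0 g0P] : exists2 g0 : R, 0 < g0 & has_pos ->
    exists2 x, 0 < kappa x x & g0 = 2^-1 * ln (1 + kappa x x / 3).
  have [[x kx_gt0]|no_pos] := pselect has_pos; last by exists 1.
  exists (2^-1 * ln (1 + kappa x x / 3)); last by exists x.
  by rewrite mulr_gt0// ln_gt0// ltrDl divr_gt0.
exists (2 * Num.sqrt (6 * (1 + K)) * Num.sqrt (2 * (1 + g0^-1))).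
  have := K_gt0; have : 0 < g0^-1 by rewrite invr_gt0.
  by move=> ? ?; rewrite !mulr_gt0 ?sqrtr_gt0//; rewrite mulr_gt0//; lra.
set c := _ * Num.sqrt (2 * _).
move=> H L xstar Bnorm k delta N B Bsmall C T d Omega P W metric theta design learn x.
move=> y eps Rsub zeta gamma rate N_gt0 Bs_gt0 Bs_B C_gt delta01 k_ge0.
move=> [f fL fB] L_max metricE mdesign exhausts run.
have [TE T_gt0 C_lt] := jobs_iterations Bs_gt0 C_gt exhausts.
split=> //.
have mx s : (s < T)%N -> measurable_fun setT (x s) by move=> /run[].
have my s : (s < T)%N -> measurable_fun setT (y s) by move=> /run[].
have me s : (s < T)%N -> measurable_fun setT (eps s) by move=> /run[].
have sg s : (s < T)%N -> subgaussian_given P (history x eps s) (eps s) Rsub by move=> /run[].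
have yE s w : y s w = L (x s w) + eps s w by rewrite /eps /prediction_error addrC subrK.
have Rsub_ge0 : 0 <= Rsub by rewrite divr_ge0 ?sqrtr_ge0.
have zeta_gt1 : 1 < zeta by rewrite ltrDl divr_gt0 ?ltr0n.
have mevent : measurable [set w | avg_regret x L xstar T w <= c * rate].
  rewrite -[X in measurable X]setTI.
  have -> : [set w | avg_regret x L xstar T w <= c * rate] =
      (fun w => avg_regret x L xstar T w <= c * rate) @^-1` [set true].
    by apply/seteqP; split.
  have : measurable_fun setT (fun w => avg_regret x L xstar T w <= c * rate).
    apply: measurable_fun_ler => //; apply: measurable_funM => //.
    apply: measurable_sum => s; apply: measurable_funB => //.
    (* Measurability of the performance at the query comes from observation minus error. *)
    have -> : (fun w => L (x s w)) = (y s \- eps s).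
      by apply/funext => w /=; rewrite yE addrK.
    by apply: measurable_funB; [exact: my|exact: me].
  by apply.
apply: le_trans (confidence kappa_meas H zeta_gt1 mx me Rsub_ge0 delta01 sg) _.
apply: le_measure; rewrite ?inE//; first exact: (measurable_confident kappa_meas H).
move=> w conf /=.
have c_ge0 : 0 <= c by rewrite !mulr_ge0 ?sqrtr_ge0.
have rate_ge0 : 0 <= rate.
  have B_ge0 : 0 <= Bnorm by exact: le_trans (sqrtr_ge0 _) fB.
  apply: mulr_ge0; first exact: sqrtr_ge0.
  by apply: addr_ge0; apply: mulr_ge0; rewrite ?sqrtr_ge0.
(* Degenerate kernel: all sections vanish, so L = 0 and the regret is 0. *)
have [pos|no_pos] := pselect has_pos; last first.
  have phi0 z : rkhs_section H z = 0.
    have k0 : kappa z z = 0.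
      apply/eqP; rewrite eq_le (kernel_ge0 H) andbT leNgt; apply/negP => kz.
      by apply: no_pos; exists z.
    by apply/normr0_eq0/eqP; rewrite -sqrf_eq0 -(rkhs_normE (r := H)) -kernelE k0.
  have L0 z : L z = 0 by rewrite -fL rkhs_reproducing phi0 linear0r.
  rewrite /avg_regret big1 ?mulr0; first exact: mulr_ge0.
  by move=> s _; rewrite !L0 subrr.
have {g0P} [x1 kx1_gt0 g0E] := g0P pos.
have zeta_gt0 : 0 < zeta := lt_trans ltr01 zeta_gt1.
have zeta_le3 : zeta <= 3.
  have : 2 / T%:R <= (2 : R) by rewrite ler_pdivrMr ?ltr0n// ler_peMr// ler1n.
  rewrite /zeta /gp_zeta; lra.
(* Repeating [x1] T times gains at least as much as querying it once, and the gain of one query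
   decreases in zeta <= 3. *)
have g0_le : g0 <= gamma.
  apply: le_trans (info_gain_le (fun _ : 'I_T => x1) (gamma_fin T T T_gt0 (leqnn T))).
  apply: le_trans (info_gain_mono H (fun=> x1) zeta_gt0 T_gt0).
  rewrite (info_gainE H zeta_gt0 (fun=> x1)) big_ord1 g0E ler_pM2l ?invr_gt0//.
  have var0 : post_var kappa zeta (fun _ : 'I_0 => x1) x1 = kappa x1 x1.
    by rewrite /post_var mxE big_ord0 subr0.
  rewrite var0 ler_ln ?posrE ?addr_gt0 ?divr_gt0// lerD2l ler_wpM2l ?(ltW kx1_gt0)//.
  by rewrite lef_pV2 ?posrE.
have ucb_max t : (t < T)%N ->
  is_argmax (fun z => post_mean kappa zeta (fun i : 'I_t => x i w)
                        (fun i => rkhs_fun f (x i w) + eps i w) z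
                      + igp_ucb_beta Bnorm Rsub delta (max_info_gain kappa zeta t)
                        * Num.sqrt (post_var kappa zeta (fun i : 'I_t => x i w) z)) (x t w).
  move=> /run[_ _ _ _ /(_ w)]; rewrite /ucb.
  have -> : (fun i : 'I_t => observation metric theta B Bsmall design learn x i w) =
            (fun i : 'I_t => rkhs_fun f (x i w) + eps i w).
    by apply/funext => i; rewrite fL -yE.
  by [].
have cum := @cumulative_regret R _ kappa H T T_gt0 K (ltW K_gt0) kappa_le
  (fun t => gamma_fin T t T_gt0) f Bnorm Rsub delta fB Rsub_ge0
  (fun i => x i w) (fun i => eps i w) xstar conf ucb_max.
rewrite fL in cum.
rewrite /avg_regret; apply: le_trans (ler_wpM2l _ cum) _; first by rewrite invr_ge0 ler0n.
apply: rate_bound => //; rewrite ?(ltW K_gt0) ?g0_gt0 ?g0_le//.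
- exact: (lnV_delta_ge0 delta01).
- exact: le_trans (sqrtr_ge0 _) fB.
exact: inv_iterations_le.
Qed.
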